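(* Let $X$ be a non-elementary cocompact generalized Baumslag--Solitar tree with group $G$. Then $X$ is fully reduced if and only if it has the smallest number of edge orbits among all generalized Baumslag--Solitar trees with group $G$.
   Context: A $G$-tree is a simplicial tree with an action of $G$ by automorphisms, without inversions; it is cocompact if its quotient graph is finite. A generalized Baumslag--Solitar tree (with group $G$) is a $G$-tree all of whose vertex and edge stabilizers are infinite cyclic. A $G$-tree is elementary if there is a $G$-invariant point or line, and non-elementary otherwise. (A generalized Baumslag--Solitar tree is elementary if and only if its group is isomorphic to $\mathbb{Z}$, $\mathbb{Z}\times\mathbb{Z}$ or the Klein bottle group.) A $G$-tree is fully reduced if no vertex stabilizer contains the stabilizer of a vertex from a different $G$-orbit; equivalently, in the quotient graph of groups no vertex group can be conjugated into the vertex group of another vertex. *)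

(* Defs.v *)
From HB Require Import structures.
From mathcomp Require Import all_boot all_order all_algebra.
From mathcomp Require Import mathcomp_extra boolp classical_sets functions.
From mathcomp Require Import cardinality.

Set Implicit Arguments.
Unset Strict Implicit.
Unset Printing Implicit Defensive.

Local Open Scope classical_set_scope.
Local Open Scope group_scope.

Definition stabilizer (G : groupType) (T : Type) (a : G -> T -> T) (x : T) :
  set G := [set g | a g x = x].

Definition orbit_of (G : groupType) (T : Type) (a : G -> T -> T) (x : T) :
  set T := [set a g x | g in [set: G]].

Definition orbits (G : groupType) (T : Type) (a : G -> T -> T) (A : set T) :
  set (set T) := [set orbit_of a x | x in A].

Definition infinite_cyclic (G : groupType) (H : set G) : Prop :=
  infinite_set H /\
  exists z : G, H = [set g | exists n : nat, g = z ^+ n \/ g = z ^- n].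

(* A simplicial tree is a nonempty connected graph, given by its adjacency
   relation, that has no embedded cycle. In [tree_acyclic] a cycle of size 2
   is an edge run in both directions. *)
Record gtree (G : groupType) : Type := GTree {
  vertex :> choiceType;
  adj : rel vertex;
  act : G -> vertex -> vertex;
  adj_sym : symmetric adj;
  adj_irr : irreflexive adj;
  tree_nonempty : inhabited vertex;
  tree_connected : forall x y, exists2 p, path adj x p & last x p = y;
  tree_acyclic : forall c, cycle adj c -> uniq c -> size c <= 2;
  act1 : forall x, act 1 x = x;
  actM : forall g h x, act (g * h) x = act g (act h x);
  act_adj : forall g x y, adj (act g x) (act g y) = adj x y;
  act_noinv : forall g x y, adj x y -> ~ (act g x = y /\ act g y = x)
}.

Section GTreeTheory.
Variables (G : groupType) (X : gtree G).

(* Edges are unoriented: an edge is the set of its two endpoints. *)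
Definition edges : set (set X) :=
  [set e | exists x y : X, adj x y /\ e = [set x; y]].

Definition act_edge (g : G) (e : set X) : set X := act g @` e.

Definition vertex_orbits : set (set X) := orbits (@act G X) [set: X].

Definition edge_orbits : set (set (set X)) := orbits act_edge edges.

Definition cocompact : Prop :=
  finite_set vertex_orbits /\ finite_set edge_orbits.

Definition gbs_tree : Prop :=
  (forall x : X, infinite_cyclic (stabilizer (@act G X) x)) /\
  (forall e, edges e -> infinite_cyclic (stabilizer act_edge e)).

(* Since there are no inversions, a group fixing a point of the open edge
   fixes both its endpoints: invariant points can be taken to be vertices. *)
Definition invariant_point : Prop := exists x : X, forall g, act g x = x.

Definition invariant_line : Prop :=
  exists l : int -> X,
    [/\ injective l, forall n : int, adj (l n) (l (n + 1)%R) &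
        forall g, act g @` range l = range l].

Definition elementary : Prop := invariant_point \/ invariant_line.

Definition fully_reduced : Prop :=
  forall x y : X, stabilizer (@act G X) x `<=` stabilizer (@act G X) y ->
    orbit_of (@act G X) x = orbit_of (@act G X) y.

End GTreeTheory.

Arguments edges [G] X _.
Arguments vertex_orbits [G] X _.
Arguments edge_orbits [G] X _.

(* Main.v *)
Require Import Defs.
From mathcomp Require Import all_boot all_order all_algebra.
From mathcomp Require Import boolp classical_sets functions cardinality.
From mathcomp Require Import zify.

(** Let X and Y be generalized Baumslag-Solitar trees with the same group G, X
    being non-elementary. They have the same elliptic elements: each vertex
    stabilizer of Y is commensurable with all its conjugates, so if its
    generator fixed no vertex of X, the axis of that generator in X would be
    preserved by G ([gbs_stab_elliptic], [gbs_elliptic_transfer]).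

    It follows that the number of edge orbits minus the number of vertex orbits
    is the same for X and Y. Topologically it is one less than the first Betti
    number of the quotient graph, whose fundamental group is G divided by the
    subgroup generated by its elliptic elements. The proof counts modulo 2: the
    functions from the vertices to Z/2 whose coboundary is G-invariant are
    described by an invariant edge function and one value, and also by a
    morphism from G to Z/2 that kills the elliptic elements and one value for
    each vertex orbit
    ([edges_to_vertices], [vertices_to_edges]). So the theorem becomes a
    statement about numbers of vertex orbits.

    If X is fully reduced, send a vertex x of X to a vertex y of Y such that the
    stabilizer of x is contained in the stabilizer of y. The latter is in turn
    contained in the stabilizer of a vertex of X, which lies in the orbit of x
    because X is fully reduced. Hence vertices in different orbits are sent to
    different orbits, and Y has at least as many orbits as X
    ([fully_reduced_edges_le]).

    Conversely, let the stabilizer of x be contained in the stabilizer of y, in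
    another orbit. If the first edge of the path from x to y leaves the orbit of
    x, collapsing it gives a tree with fewer vertex orbits
    ([collapse_ascending_edge]). Otherwise, run backwards, it is an ascending
    edge: up to translation, an edge (x, t x) such that the stabilizer of t x is
    contained in the stabilizer of x, with some index N. Call a number N-smooth when all its primes divide
    N. The path from x to y contains an edge, with a translate (x, z), whose
    index d at x is N-smooth and which either leaves the orbit of x or has at z
    an index divisible by a prime p that does not divide N ([dominated_exit]).
    The induction move ([induction_move]) keeps the number of vertex orbits,
    replaces the stabilizer of x by its subgroup of index gcd(d, N), and so
    replaces d by d / gcd(d, N). When d has become 1, either the edge leaves the
    orbit and is collapsed, or it is itself an ascending edge, and one more move
    makes its index divisible by both N and p ([ascending_grows]). The second
    case cannot repeat forever, because all primes that occur divide the index of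
    an edge group of the original tree X ([prime_ascending_index]). *)

Set Implicit Arguments.
Unset Strict Implicit.
Unset Printing Implicit Defensive.
Import GRing.Theory Num.Theory Order.TTheory.
Local Open Scope classical_set_scope.
Local Open Scope card_scope.

(** * Cuts and geodesics of trees *)

Section Cuts.
Variables (V : eqType) (e : rel V).

Definition same_edge (u v p q : V) : bool :=
  (p == u) && (q == v) || (p == v) && (q == u).

(** The function s is the indicator of one of the two sides of the edge uv. Cuts
    are the working form of acyclicity: they are easy to transport along maps
    between graphs, whereas cycles are not. *)
Definition cut_at (s : V -> bool) (u v : V) : Prop :=
  s u != s v /\ forall p q, e p q -> s p != s q -> same_edge u v p q.

(** The side of u consists of the vertices that can be joined to u without the
    edge uv. A path from u to v avoiding uv would close up to a cycle. *)
Lemma cut_exists (e_sym : symmetric e)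
    (acyc : forall c, cycle e c -> uniq c -> size c <= 2) u v :
  e u v -> u != v -> exists s, cut_at s u v.
Proof.
move=> euv uNv.
pose e' := [rel p q | e p q && ~~ same_edge u v p q].
have same_sym p q : same_edge u v q p = same_edge u v p q.
  by rewrite /same_edge orbC andbC [X in _ || X]andbC.
exists (fun w => `[< exists2 p, path e' u p & last u p = w >]); split.
  have -> : `[< exists2 p, path e' u p & last u p = u >] = true.
    by apply/asboolP; exists [::].
  case: asboolP => // -[p0 p0P]; case: (shortenP p0P) => p pP up _ lastp.
  have pe : path e u p by apply: sub_path pP => a b /andP[].
  case: p pP up lastp pe => [|a [|b p]] /=.
  - by move=> _ _ uv; rewrite uv eqxx in uNv.
  - move=> /andP[/andP[_ ns] _] _ av _.
    by move: ns; rewrite /same_edge av !eqxx.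
  - move=> _ up lastp pe.
    have := acyc (u :: a :: b :: p).
    rewrite /= in up *; rewrite up => /(_ _ isT).
    rewrite rcons_path -/(path _ _ _) /= in pe *.
    by case/and3P: pe => -> -> -> /=; rewrite lastp e_sym euv => /(_ isT).
move=> p q epq; apply: contraNT => ns.
have step a b : e a b -> ~~ same_edge u v a b ->
    (exists2 p, path e' u p & last u p = a) -> exists2 p, path e' u p & last u p = b.
  move=> eab nsab [r rP ra]; exists (rcons r b); last by rewrite last_rcons.
  by rewrite rcons_path rP ra /= eab nsab.
apply/eqP; apply/asbool_equiv_eq; split; apply: step => //.
  by rewrite e_sym.
by rewrite same_sym.
Qed.

Lemma cut_at_path s u v x p : cut_at s u v -> path e x p -> u \notin x :: p ->
  s x = s (last x p).
Proof.
move=> [_ sP]; elim: p x => //= a p IH x /andP[exa pa].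
rewrite inE negb_or => /andP[ux]; rewrite inE negb_or => /andP[ua up].
rewrite -IH //; last by rewrite inE negb_or ua.
apply/eqP; apply: contraT => /(sP _ _ exa) /orP[] /andP[/eqP xx /eqP aa].
  by rewrite xx eqxx in ux.
by rewrite aa eqxx in ua.
Qed.

(** A cycle crosses each of its edges only once, but a cut must be crossed an even
    number of times. *)
Lemma acyclic_of_cuts (cuts : forall u v, e u v -> exists s, cut_at s u v) c :
  cycle e c -> uniq c -> size c <= 2.
Proof.
case: c => [|u [|v [|w c]]] //= /and3P[euv evw pc] /and4P[uN vN wN uc].
have [s sP] := cuts _ _ euv.
rewrite rcons_path in pc; case/andP: pc => pc ezu.
have sv : s v = s (last w c).
  rewrite (@cut_at_path s u v v (w :: c)) //= ?evw ?pc //.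
have [suv sP'] := sP.
have := sP' _ _ ezu; rewrite -sv eq_sym suv => /(_ isT) /orP[] /andP[/eqP zu /eqP uv].
  by move: uN; rewrite uv inE eqxx.
by move: vN; rewrite -zu mem_last.
Qed.

(** Where two simple paths diverge, the cut at the first edge of one of them
    separates their endpoints. *)
Lemma simple_path_unique (cuts : forall u v, e u v -> exists s, cut_at s u v)
    x p q : path e x p -> path e x q -> uniq (x :: p) -> uniq (x :: q) ->
  last x p = last x q -> p = q.
Proof.
elim: p x q => [|a p IH] x [|b q] //=.
- by move=> _ _ _ /andP[xN _] xl; case/negP: xN; rewrite [X in X \in _]xl mem_last.
- by move=> _ _ /andP[xN _] _ xl; case/negP: xN; rewrite -[X in X \in _]xl mem_last.
move=> /andP[exa pa] /andP[exb pb] /andP[xp up] /andP[xq uq] lpq.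
case: (eqVneq a b) => [ab|ab].
  by rewrite -ab in pb lpq uq *; rewrite (IH a q).
have [s sP] := cuts _ _ exa.
have sa := cut_at_path sP pa xp; have sb := cut_at_path sP pb xq.
have [sxa sP'] := sP; have := sP' _ _ exb; rewrite sb -lpq -sa sxa => /(_ isT).
rewrite /same_edge eqxx eq_sym (negbTE ab) /= => /andP[/eqP xa _].
by move: xp; rewrite xa inE eqxx.
Qed.

End Cuts.

Section Geodesics.
Variables (V : choiceType) (e : rel V).
Hypothesis e_sym : symmetric e.
Hypothesis e_conn : forall x y, exists2 p, path e x p & last x p = y.
Hypothesis e_cuts : forall u v, e u v -> exists s, cut_at e s u v.

Definition simple_to (x y : V) (p : seq V) : bool :=
  [&& path e x p, uniq (x :: p) & last x p == y].

Lemma simple_to_exists x y : exists p, simple_to x y p.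
Proof.
have [p pP <-] := e_conn x y; case: (shortenP pP) => q qP uq _.
by exists q; apply/and3P.
Qed.

Definition geod x y : seq V := xchoose (simple_to_exists x y).
Definition dist x y : nat := size (geod x y).

Lemma geodP x y : simple_to x y (geod x y).
Proof. exact: (xchooseP (simple_to_exists x y)). Qed.

Lemma geodE x y p : simple_to x y p -> p = geod x y.
Proof.
case/and3P=> pP up /eqP lp; case/and3P: (geodP x y) => gP ug /eqP lg.
by apply: (simple_path_unique e_cuts pP gP up ug); rewrite lp lg.
Qed.

(** Removing its loops from a path leaves the geodesic. *)
Lemma geod_sub x p z : path e x p -> z \in geod x (last x p) -> z \in p.
Proof.
move=> pP; case: (shortenP pP) => q qP uq sub zq; apply: sub => //.
by rewrite (@geodE x (last x q) q) //; apply/and3P.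
Qed.

Lemma dist_path x p : path e x p -> dist x (last x p) <= size p.
Proof.
move=> pP; have /and3P[_ /andP[_ ug] _] := geodP x (last x p).
by apply: uniq_leq_size => // z; apply: geod_sub.
Qed.

Lemma geod_path x y : path e x (geod x y).
Proof. by case/and3P: (geodP x y). Qed.
Lemma geod_last x y : last x (geod x y) = y.
Proof. by case/and3P: (geodP x y) => _ _ /eqP. Qed.
Lemma geod_uniq x y : uniq (x :: geod x y).
Proof. by case/and3P: (geodP x y). Qed.

Lemma dist_triangle y x z : dist x z <= dist x y + dist y z.
Proof.
have := @dist_path x (geod x y ++ geod y z).
rewrite cat_path last_cat !geod_last size_cat; apply.
by rewrite !geod_path.
Qed.

(** Triangles are tripods: by [geod_sub], two sides in succession contain the
    third. *)
Lemma geod_triangle y x z w : w \in geod x z -> w \in geod x y \/ w \in geod y z.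
Proof.
move=> wxz; apply/orP; rewrite -mem_cat; apply: (@geod_sub x).
  by rewrite cat_path geod_last !geod_path.
by rewrite last_cat !geod_last.
Qed.

Lemma dist_sym x y : dist x y = dist y x.
Proof.
suff H a b : dist a b <= dist b a by apply/eqP; rewrite eqn_leq !H.
have := @dist_path a (rev (belast b (geod b a))).
rewrite size_rev size_belast.
have -> : last a (rev (belast b (geod b a))) = b.
  case E : (geod b a) => [|c s] /=; first by have := geod_last b a; rewrite E.
  by rewrite rev_cons last_rcons.
apply; have := rev_path e b (geod b a); rewrite geod_last => ->.
rewrite -(@eq_path _ e) ?geod_path // => u v /=; exact: e_sym.
Qed.

Lemma dist_edge x y : e x y -> dist x y <= 1.
Proof. by move=> exy; apply: (@dist_path x [:: y]); rewrite /= exy. Qed.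

Lemma geod_dist x y z : z \in geod x y -> dist x z <= dist x y /\ dist z y <= dist x y.
Proof.
move=> zg; have gP := geod_path x y; have gl := geod_last x y; rewrite /dist.
case/splitPr: zg gP gl => p1 p2; rewrite cat_path last_cat /= => /and3P[P1 ez P2] lz.
rewrite size_cat /=; split.
  apply: leq_trans (_ : size (rcons p1 z) <= _); last by rewrite size_rcons addnS ltnS leq_addr.
  by have := @dist_path x (rcons p1 z); rewrite last_rcons rcons_path P1 ez; apply.
apply: leq_trans (_ : size p2 <= _); last by rewrite addnS ltnW // ltnS leq_addl.
by have := @dist_path z p2 P2; rewrite lz.
Qed.

Fixpoint path_sum (c : V -> V -> bool) x p : bool :=
  if p is a :: p' then c x a (+) path_sum c a p' else false.

Lemma path_sum_rcons c x p y : path_sum c x (rcons p y) = path_sum c x p (+) c (last x p) y.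
Proof.
elim: p x => [|a p IH] x /=; first by rewrite addbF.
by rewrite IH addbA.
Qed.

(** A tree is simply connected, so every function on its edges with values in Z/2
    is the coboundary of a function on its vertices: sum it along the geodesics
    from a base vertex. *)
Lemma integrate (c : V -> V -> bool) (x0 : V) (b : bool) :
  (forall u v, c u v = c v u) ->
  exists2 f : V -> bool, f x0 = b & forall u v, e u v -> f u (+) f v = c u v.
Proof.
move=> c_sym.
have H u v : e u v -> v \notin x0 :: geod x0 u ->
    path_sum c x0 (geod x0 v) = path_sum c x0 (geod x0 u) (+) c u v.
  move=> euv vN; rewrite -(@geodE x0 v (rcons (geod x0 u) v)).
    by rewrite path_sum_rcons geod_last.
  apply/and3P; split; last by rewrite last_rcons.
    by rewrite rcons_path geod_path geod_last.
  by rewrite -rcons_cons rcons_uniq vN geod_uniq.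
exists (fun v => b (+) path_sum c x0 (geod x0 v)).
  by rewrite -(@geodE x0 x0 [::]) /= ?addbF //; apply/and3P.
move=> u v euv.
have [vin|/(H _ _ euv)->] := boolP (v \in x0 :: geod x0 u); last first.
  by rewrite addbACA addbb /= addbA addbb.
(* One of the geodesics from x0 to u and to v extends the other by the edge uv. *)
have uN : u \notin x0 :: geod x0 v; last first.
  have euv' := euv; rewrite e_sym in euv'.
  by rewrite (H _ _ euv' uN) addbACA addbb /= [_ (+) c v u]addbC -addbA addbb addbF c_sym.
have := geod_uniq x0 u; have := geod_path x0 u; have := geod_last x0 u.
case/splitPl: vin => p1 p2 lp1; rewrite last_cat cat_path -cat_cons cat_uniq lp1.
move=> lp2 /andP[P1 P2] /and3P[U1 dis U2].
rewrite -(@geodE x0 v p1); last by apply/and3P; split=> //; rewrite lp1.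
apply/negP => uin; move/hasPn: dis => dis.
case: p2 lp2 dis {P2 U2} => [|a p2] /= lp2 dis.
  have [s [suv _]] := e_cuts euv; by rewrite lp2 eqxx in suv.
by have := dis u; rewrite -lp2 mem_last lp2 /= uin => /(_ isT).
Qed.

End Geodesics.

(** * Subgroups of infinite cyclic groups *)

Section CyclicSubgroups.
Variable G : groupType.
Implicit Types (A B C : set G) (a b g h : G) (k l : int) (d n : nat).

Definition zpow a k : G :=
  match k with Posz n => (a ^+ n)%g | Negz n => (a ^- n.+1)%g end.

Lemma zpow_nat a n : zpow a (Posz n) = (a ^+ n)%g. Proof. by []. Qed.

Lemma zpow_opp_nat a n : zpow a (- Posz n)%R = (a ^- n)%g.
Proof. by case: n => [|n] //=; rewrite ?expg0 ?invg1. Qed.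

Lemma zpowS a k : zpow a (k + 1)%R = (zpow a k * a)%g.
Proof.
elim/int_ind: k => [|n _|n _].
- by rewrite add0r /= mul1g.
- by rewrite -[(_ + 1)%R]/(Posz (n.+1 + 1)) addn1 !zpow_nat expgSr.
rewrite -[in LHS]addn1 PoszD opprD addrNK !zpow_opp_nat expgS invgM.
by rewrite mulgVK.
Qed.

Lemma zpowD a k l : zpow a (k + l)%R = (zpow a k * zpow a l)%g.
Proof.
elim/int_ind: l => [|n IH|n IH].
- by rewrite addr0 /= mulg1.
- by rewrite -addn1 PoszD addrA !zpowS IH mulgA.
apply: (mulIg a); rewrite -zpowS -mulgA -zpowS -addn1 PoszD opprD.
by rewrite -addrA addrNK IH.
Qed.

Lemma zpowN a k : zpow a (- k)%R = (zpow a k)^-1%g.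
Proof. by apply/esym/mulg1_eq; rewrite -zpowD subrr. Qed.

Lemma zpow1 a : zpow a 1%R = a. Proof. by []. Qed.

Lemma zpowM a k l : zpow a (k * l)%R = zpow (zpow a k) l.
Proof.
elim/int_ind: l => [|n IH|n IH]; first by rewrite mulr0.
  by rewrite -addn1 PoszD mulrDr mulr1 !zpowS zpowD IH.
apply: (mulIg (zpow a k)); rewrite -zpowD -zpowS -[X in (_ + X)%R]mulr1 -mulrDr.
by rewrite -addn1 PoszD opprD addrNK IH.
Qed.

Lemma zpow_conj a g k : zpow (g * a * g^-1)%g k = (g * zpow a k * g^-1)%g.
Proof.
have E b : (g * b * g^-1 = b ^ g^-1)%g by rewrite conjgE invgK mulgA.
by case: k => n /=; rewrite !E ?conjVg conjXg.
Qed.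

Definition free_generator A a : Prop :=
  injective (zpow a) /\ forall g, A g <-> exists k, g = zpow a k.

Definition subgroup A : Prop :=
  [/\ A 1%g, forall g h, A g -> A h -> A (g * h)%g & forall g, A g -> A (g^-1)%g].

Lemma free_generator_subgroup A a : free_generator A a -> subgroup A.
Proof.
case=> _ gA; split; first by apply/gA; exists 0%R.
  by move=> g h /gA[k ->] /gA[l ->]; apply/gA; exists (k + l)%R; rewrite zpowD.
by move=> g /gA[k ->]; apply/gA; exists (- k)%R; rewrite zpowN.
Qed.

Lemma zpow_injective a : (forall n, a ^+ n.+1 != 1)%g -> injective (zpow a).
Proof.
move=> tf k l /eqP; rewrite -divg_eq1 -zpowN -zpowD => kl.
apply/eqP; rewrite -subr_eq0; apply: contraTT kl.
case: (k - l)%R => [[|n]|n] // _; first exact: tf.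
by rewrite [zpow _ _]/(a ^- n.+1)%g invg_eq1 tf.
Qed.

Lemma infinite_cyclicP A : infinite_cyclic A <-> exists a, free_generator A a.
Proof.
have zE a g : (exists n, g = (a ^+ n)%g \/ g = (a ^- n)%g) <-> exists k, g = zpow a k.
  split=> [[n [->|->]]|[[n|n] ->]].
  - by exists (Posz n).
  - by exists (- Posz n)%R; rewrite zpow_opp_nat.
  - by exists n; left.
  - by exists n.+1; right.
split=> [[infA [a AE]]|[a [a_inj AE]]].
  exists a; split; last by move=> g; rewrite AE /=; exact: zE.
  apply: zpow_injective => m; apply/eqP => am.
  apply: infA; apply: (@sub_finite_set _ _ [set (a ^+ i)%g | i in `I_m.+1]); last first.
    by apply: finite_image; exact: finite_II.
  have red n : (a ^+ n = a ^+ (n %% m.+1))%g.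
    by rewrite {1}(divn_eq n m.+1) expgnDr mulnC expgnA am expg1n mul1g.
  move=> g; rewrite AE /= => -[n [->|->]].
    by exists (n %% m.+1); [rewrite /= ltn_mod | rewrite -red].
  exists ((n * m) %% m.+1); first by rewrite /= ltn_mod.
  rewrite -red; apply/esym/mulg1_eq; rewrite -expgnDr -mulnS.
  by rewrite mulnC expgnA am expg1n.
split; last by exists a; apply/seteqP; split=> g /=; rewrite AE zE.
move=> finA; apply: infinite_nat; pose f (n : nat) := (a ^+ n)%g.
have -> : [set: nat] = f @^-1` A.
  by apply/seteqP; split=> // n _; apply/AE; exists (Posz n).
apply: finite_preimage finA => m n _ _; rewrite /f -!zpow_nat => /a_inj.
by case.
Qed.

(** The index d is read off from the powers of a generator that lie in B. By
    [has_indexE] the choice of the generator does not matter. *)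
Definition has_index A B d : Prop :=
  0 < d /\ (forall g, B g -> A g) /\
  exists2 a, free_generator A a & forall k, B (zpow a k) <-> (d %| k)%Z.

Lemma free_generator_unique A a b : free_generator A a -> free_generator A b ->
  exists2 k, `|k|%N = 1%N & b = zpow a k.
Proof.
move=> [ia gA] [ib gB].
have /gA[k bk] : A b by apply/gB; exists 1%R.
have /gB[l al] : A a by apply/gA; exists 1%R.
exists k => //; have : zpow a (k * l)%R = zpow a 1%R by rewrite zpowM -bk -al.
move/ia => /(congr1 absz); rewrite abszM => /eqP; rewrite muln_eq1.
by case/andP=> /eqP.
Qed.

Lemma has_indexE A B d a : has_index A B d -> free_generator A a ->
  forall k, B (zpow a k) <-> (d %| k)%Z.
Proof.
case=> _ [_ [b gb bE]] ga k; have [l l1 ->] := free_generator_unique gb ga.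
by rewrite -zpowM bE dvdzE abszM l1 mul1n.
Qed.

Lemma has_index_sub A B d g : has_index A B d -> B g -> A g.
Proof. by case=> _ [sub _]; exact: sub. Qed.

Lemma has_index_gen A B d a : has_index A B d -> free_generator A a ->
  free_generator B (zpow a (Posz d)).
Proof.
move=> iAB ga; have BE := has_indexE iAB ga; have [d0 [sub _]] := iAB.
have [ia gA] := ga; split.
  move=> k l; rewrite -!zpowM => /ia /mulfI; apply.
  by rewrite eqz_nat -lt0n.
move=> g; split=> [Bg|[k ->]]; last by rewrite -zpowM; apply/BE/dvdz_mulr.
have /gA[k gk] := sub _ Bg; move: Bg; rewrite gk => /BE /dvdzP[q ->].
by exists q; rewrite mulrC zpowM.
Qed.

Lemma has_index_unique A B d d' : has_index A B d -> has_index A B d' -> d = d'.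
Proof.
move=> i1 i2; have [_ [_ [a ga _]]] := i1.
have E1 := has_indexE i1 ga; have E2 := has_indexE i2 ga.
apply/eqP; rewrite eqn_dvd; apply/andP; split.
  by have /E2/E1 : (d' %| (Posz d'))%Z by [].
by have /E1/E2 : (d %| (Posz d))%Z by [].
Qed.

Lemma has_index_trans A B C d e : has_index A B d -> has_index B C e ->
  has_index A C (d * e).
Proof.
move=> iAB iBC; have [d0 [sAB [a ga aE]]] := iAB; have [e0 [sBC _]] := iBC.
have CE := has_indexE iBC (has_index_gen iAB ga).
split; [by rewrite muln_gt0 d0|split=> [g /sBC/sAB //|]].
exists a => // k; split=> [Ck|].
  have /aE /dvdzP[q kq] : B (zpow a k) by exact: sBC.
  move: Ck; rewrite kq mulrC zpowM => /CE; rewrite !dvdzE abszM.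
  by rewrite dvdn_pmul2l.
case/dvdzP=> q ->; rewrite PoszM mulrCA zpowM.
by apply/CE/dvdz_mull.
Qed.

(** The index is the least positive exponent of a power that lies in B. *)
Lemma has_index_exists A B a : free_generator A a -> subgroup B ->
  (forall g, B g -> A g) -> (exists2 g, g != 1%g & B g) -> exists d, has_index A B d.
Proof.
move=> ga [B1 BM BV] sub [g g1 Bg]; have [ia gA] := ga.
have BVE k : B (zpow a k) -> B (zpow a `|k|%N).
  by move=> Bk; case: (intP k) Bk => // n Bn; rewrite abszN -[Posz _]opprK zpowN; exact: BV.
have ex : exists n, (0 < n) && `[< B (a ^+ n)%g >].
  have /gA[k gk] := sub _ Bg; exists `|k|%N; apply/andP; split.
    by rewrite absz_gt0; apply: contraNneq g1 => k0; rewrite gk k0.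
  by apply/asboolP; rewrite -zpow_nat; apply: BVE; rewrite -gk.
pose d := ex_minn ex; exists d; rewrite /d; case: ex_minnP => m /andP[m0 /asboolP Bm] mmin.
have Bz k : (m %| k)%Z -> B (zpow a k).
  case/dvdzP=> q ->; rewrite mulrC zpowM zpow_nat.
  elim/int_ind: q => [|n IH|n IH] //.
    by rewrite -addn1 PoszD zpowS; exact: BM.
  rewrite -addn1 PoszD zpowN zpowD; apply: (BV); apply: (BM) => //.
  by rewrite -[zpow _ _]invgK -zpowN; exact: BV.
split=> //; split=> //; exists a => // k; split=> [Bk|]; last exact: Bz.
apply: contraT => ndvd.
have m0' : (Posz m) != 0%R by rewrite eqz_nat -lt0n.
have Bmod : B (zpow a (k %% m)%Z).
  rewrite /modz zpowD; apply: (BM) => //; apply: (Bz); rewrite dvdzE abszN abszM dvdn_mull //.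
have mn : (0 <= k %% m)%Z%R by rewrite modz_ge0.
have := mmin `|(k %% m)%Z|%N; rewrite absz_gt0.
have -> : ((k %% m)%Z != 0%R) by apply: contra ndvd => /eqP/dvdz_mod0P.
have -> : `[< B (a ^+ `|(k %% m)%Z|)%g >] by apply/asboolP; rewrite -zpow_nat; exact: BVE.
move=> /(_ isT); rewrite leqNgt -ltz_nat gez0_abs //.
by rewrite ltz_pmod.
Qed.

Lemma has_index_dvd A B C d e : has_index A B d -> has_index A C e ->
  (forall g, C g -> B g) -> exists2 f, has_index B C f & e = d * f.
Proof.
move=> iB iC sCB; have [d0 [sB [a ga aE]]] := iB; have CE := has_indexE iC ga.
have de : d %| e by have /CE/sCB/aE : (e %| (Posz e))%Z by [].
have e0 : 0 < e by case: iC.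
exists (e %/ d); last by rewrite mulnC divnK.
split; [by rewrite divn_gt0 // dvdn_leq|split=> //].
exists (zpow a (Posz d)); first exact: has_index_gen iB ga.
move=> k; rewrite -zpowM CE !dvdzE abszM -[X in X %| _](divnK de) mulnC.
by rewrite dvdn_pmul2l.
Qed.

Definition power_subgroup a d : set G := [set g | exists k, g = zpow (zpow a (Posz d)) k].

Lemma has_index_nat A a d : 0 < d -> free_generator A a -> has_index A (power_subgroup a d) d.
Proof.
move=> d0 ga; have [ia gA] := ga; split=> //; split.
  by move=> g [k ->]; apply/gA; exists ((Posz d) * k)%R; rewrite zpowM.
exists a => // k; split=> [[l]|/dvdzP[q ->]].
  by rewrite -zpowM => /ia ->; apply: dvdz_mulr.
by exists q; rewrite mulrC zpowM.
Qed.

(** The subgroups of A are generated by the powers of its generator a; the join of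
    those generated by a^d and a^e is generated by a^gcd(d, e). *)
Lemma has_index_join A B C d e : has_index A B d -> has_index A C e ->
  exists D, [/\ has_index A D (gcdn d e), forall g, B g -> D g & forall g, C g -> D g].
Proof.
move=> iB iC; have [d0 [sB [a ga aE]]] := iB; have [e0 [sC _]] := iC.
have CE := has_indexE iC ga; have [_ gA] := ga.
have iD : has_index A (power_subgroup a (gcdn d e)) (gcdn d e).
  by apply: has_index_nat => //; rewrite gcdn_gt0 d0.
have DE := has_indexE iD ga.
exists (power_subgroup a (gcdn d e)); split=> // g Hg.
  have /gA[k gk] := sB _ Hg; move: Hg; rewrite gk => /aE dk.
  by apply/DE; rewrite dvdzE (dvdn_trans (dvdn_gcdl _ _)).
have /gA[k gk] := sC _ Hg; move: Hg; rewrite gk => /CE dk.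
by apply/DE; rewrite dvdzE (dvdn_trans (dvdn_gcdr _ _)).
Qed.

Lemma has_index_meet A B C d e : has_index A B d -> has_index A C e ->
  has_index A (B `&` C) (lcmn d e).
Proof.
move=> iB iC; have [d0 [sB [a ga aE]]] := iB; have [e0 [sC _]] := iC.
have CE := has_indexE iC ga.
split; [by rewrite lcmn_gt0 d0|split=> [g []/sB //|]].
exists a => // k; rewrite dvdzE dvdn_lcm; split=> [[/aE + /CE]|/andP[/aE + /CE]] //.
by rewrite !dvdzE => -> ->.
Qed.

Definition conj_set g A : set G := [set h | A (g^-1 * h * g)%g].

Lemma free_generator_conj g A a : free_generator A a -> free_generator (conj_set g A) (g * a * g^-1)%g.
Proof.
move=> [ia gA]; split=> [k l|h].
  by rewrite !zpow_conj => /mulIg /mulgI /ia.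
rewrite /conj_set /= gA; split=> -[k E]; exists k.
  by rewrite zpow_conj -E !mulgA mulgV mul1g mulgK.
by rewrite E zpow_conj !mulgA mulVg mul1g mulgVK.
Qed.

Lemma has_index_conj g A B d : has_index A B d ->
  has_index (conj_set g A) (conj_set g B) d.
Proof.
move=> [d0 [sub [a ga aE]]]; split=> //; split; first by move=> h; exact: sub.
exists (g * a * g^-1)%g; first exact: free_generator_conj.
by move=> k; rewrite zpow_conj /conj_set /= !mulgA mulVg mul1g mulgVK.
Qed.

Lemma has_index_refl A a : free_generator A a -> has_index A A 1.
Proof.
move=> ga; have [ia gA] := ga; split=> //; split=> //; exists a => // k.
by rewrite dvdzE dvd1n; split=> // _; apply/gA; exists k.
Qed.

Lemma has_index1 A B : has_index A B 1 -> forall g, A g -> B g.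
Proof.
move=> [_ [_ [a [_ gA] aE]]] g /gA[k ->]; apply/aE.
by rewrite dvdzE dvd1n.
Qed.

(** If b = a^k and g = a^l for a generator a, then b^l = g^k. *)
Lemma free_generator_meet A a b g : free_generator A a -> A b -> A g -> b != 1%g -> g != 1%g ->
  exists k l, [/\ k != 0%R, l != 0%R & zpow b k = zpow g l].
Proof.
move=> [ia gA] /gA[k ->] /gA[l ->] b1 g1.
exists l, k; split.
- by apply: contraNneq g1 => ->.
- by apply: contraNneq b1 => ->.
- by rewrite -!zpowM mulrC.
Qed.

Lemma free_generator_torsion_free A a b k : free_generator A a -> A b -> b != 1%g -> k != 0%R -> zpow b k != 1%g.
Proof.
move=> [ia gA] /gA[l ->] b1 k0; rewrite -zpowM; apply/eqP => /(@ia _ 0%R) /eqP.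
rewrite mulf_eq0 (negPf k0) orbF => /eqP l0.
by rewrite l0 eqxx in b1.
Qed.

Lemma free_generator_neq1 A a : free_generator A a -> a != 1%g.
Proof. by move=> [ia _]; apply/eqP => a1; have := @ia 1%R 0%R; rewrite /= expg1 a1 => /(_ erefl). Qed.

Lemma free_generator_mem A a : free_generator A a -> A a.
Proof. by move=> [_ gA]; apply/gA; exists 1%R. Qed.

End CyclicSubgroups.

(** * Automorphisms of trees and their axes *)

Section TreeGeometry.
Variables (G : groupType) (X : gtree G).
Implicit Types (x y z u v : X) (g h : G).

Lemma tree_cuts u v : adj u v -> exists s, cut_at (@adj G X) s u v.
Proof.
move=> uv; apply: cut_exists => //; first exact: adj_sym.
  exact: tree_acyclic.
by apply: contraTneq uv => ->; rewrite adj_irr.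
Qed.

Definition tree_geod x y : seq X := geod (@tree_connected G X) x y.
Definition tree_dist x y : nat := dist (@tree_connected G X) x y.

Lemma actK g : cancel (@act G X g) (act g^-1%g).
Proof. by move=> x; rewrite -actM mulVg act1. Qed.

Lemma actVK g : cancel (@act G X g^-1%g) (act g).
Proof. by move=> x; rewrite -actM mulgV act1. Qed.

Lemma act_inj g : injective (@act G X g).
Proof. exact: can_inj (actK g). Qed.

Lemma path_act g x p : path (@adj G X) (act g x) (map (act g) p) = path (@adj G X) x p.
Proof. by elim: p x => //= a p IH x; rewrite IH act_adj. Qed.

Lemma tree_geodE x y p : simple_to (@adj G X) x y p -> p = tree_geod x y.
Proof. exact: (geodE (@tree_connected G X) tree_cuts). Qed.

Lemma tree_geod_act g x y : tree_geod (act g x) (act g y) = map (act g) (tree_geod x y).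
Proof.
apply/esym/tree_geodE; case/and3P: (geodP (@tree_connected G X) x y) => P U /eqP L.
apply/and3P; split; first by rewrite path_act.
  by rewrite -map_cons (map_inj_uniq (@act_inj g)).
by rewrite last_map L.
Qed.

Lemma tree_dist_act g x y : tree_dist (act g x) (act g y) = tree_dist x y.
Proof. by rewrite /tree_dist /dist -!/(tree_geod _ _) tree_geod_act size_map. Qed.

(** The image of the path from x to y is a simple path with the same ends, hence
    the same path. *)
Lemma tree_geod_fixed g x y z : act g x = x -> act g y = y -> z \in tree_geod x y -> act g z = z.
Proof.
move=> gx gy; have := tree_geod_act g x y; rewrite gx gy => E.
have /eq_in_map H : map (act g) (tree_geod x y) = map id (tree_geod x y) by rewrite -E map_id.
by move=> zi; apply: (H z).
Qed.

Lemma tree_dist_triangle y x z : tree_dist x z <= tree_dist x y + tree_dist y z.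
Proof. exact: (dist_triangle (@tree_connected G X) tree_cuts). Qed.

Lemma tree_dist_sym x y : tree_dist x y = tree_dist y x.
Proof. exact: (dist_sym (@adj_sym G X) (@tree_connected G X) tree_cuts). Qed.

Lemma tree_dist_edge x y : adj x y -> tree_dist x y <= 1.
Proof. exact: (dist_edge (@tree_connected G X) tree_cuts). Qed.

Lemma tree_dist0 x : tree_dist x x = 0.
Proof. by rewrite /tree_dist /dist -/(tree_geod _ _) -(@tree_geodE x x [::]) //; apply/and3P. Qed.

Lemma tree_dist_eq0 x y : tree_dist x y = 0 -> x = y.
Proof.
rewrite /tree_dist /dist => /size0nil E; have := geod_last (@tree_connected G X) x y.
by rewrite E.
Qed.

Lemma tree_geod_refl y : tree_geod y y = [::].
Proof. by apply/esym/tree_geodE/and3P. Qed.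

Lemma tree_geod_adj y z : adj y z -> tree_geod y z = [:: z].
Proof.
move=> yz; apply/esym/tree_geodE/and3P; split=> //=; first by rewrite yz.
by rewrite inE andbT; apply: contraTneq yz => ->; rewrite adj_irr.
Qed.

(** The branches at y are unions of components of the tree with y removed. *)
Lemma tree_geod_branch y a u v : adj y a -> adj u v -> u != y -> v != y ->
  a \in tree_geod y u -> a \in tree_geod y v.
Proof.
move=> ya uv uy vy ain.
have [//|] := @geod_triangle _ _ (@tree_connected G X) tree_cuts v _ _ _ ain.
rewrite -/(tree_geod v u) tree_geod_adj; last by rewrite adj_sym.
rewrite inE => /eqP au; rewrite -(@tree_geodE y v [:: u; v]) ?inE ?au ?eqxx //.
rewrite au in ya; apply/and3P; split=> //=; first by rewrite ya uv.
rewrite !inE negb_or !andbT eq_sym uy eq_sym vy /=.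
by apply: contraTneq uv => ->; rewrite adj_irr.
Qed.

Section Line.
Variable l : int -> X.
Hypothesis l_adj : forall n, adj (l n) (l (n + 1)%R).
Hypothesis l_straight : forall n : int, l (n + 2)%R <> l n.

(** In a tree, absence of backtracking suffices for a path to be simple, so that
    lines are recognized by a local condition. *)
Lemma line_simple i n :
  simple_to (@adj G X) (l i) (l (i + Posz n)%R)
    (mkseq (fun k => l (i + Posz k.+1)%R) n).
Proof.
elim: n => [|n IH]; first by apply/and3P; rewrite addr0.
have mkS : mkseq (fun k => l (i + Posz k.+1)%R) n.+1 =
    rcons (mkseq (fun k => l (i + Posz k.+1)%R) n) (l (i + Posz n.+1)%R).
  by rewrite /mkseq -[in iota _ _]addn1 iotaD map_cat cats1 add0n.
have adjn : adj (l (i + Posz n)%R) (l (i + Posz n.+1)%R).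
  by have := l_adj (i + Posz n)%R; rewrite -addrA -PoszD addn1.
rewrite mkS; case/and3P: IH => P U /eqP L.
apply/and3P; split; last by rewrite last_rcons.
  by rewrite rcons_path P L.
rewrite -rcons_cons rcons_uniq U andbT; apply/negP => uin.
have [p pE] : exists p, mkseq (fun k => l (i + Posz k.+1)%R) n = p by eexists.
move: mkS P U L uin; rewrite pE => mkS P U L uin.
case/splitPl: uin pE P U L {mkS} => p1 p2 lp1.
rewrite cat_path -cat_cons cat_uniq last_cat lp1.
move=> pE /andP[P1 P2] /and3P[U1 dis U2] L.
(* If the next vertex already occurs, then by uniqueness of simple paths it is the
   last but one, which straightness excludes. *)
have p2E : p2 = [:: l (i + Posz n)%R].
  transitivity (tree_geod (l (i + Posz n.+1)%R) (l (i + Posz n)%R)).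
    apply: tree_geodE; apply/and3P; split=> //; last by rewrite L.
    rewrite /= U2 andbT; apply: contra dis => uin2; apply/hasP.
    by exists (l (i + Posz n.+1)%R) => //=; rewrite -lp1 mem_last.
  apply/esym/tree_geodE; apply/and3P; split=> //=; first by rewrite adj_sym adjn.
  rewrite inE andbT; apply: contraTneq adjn => ->; by rewrite adj_irr.
move: pE; rewrite p2E cats1; case: n {adjn P1 P2 U1 U2 dis L p2E} lp1 => [|n] lp1 //=.
  by move/(congr1 size); rewrite size_rcons.
rewrite /mkseq -[in iota _ _]addn1 iotaD map_cat cats1 => /rcons_inj/(congr1 fst) /= pE.
have := lp1; rewrite -pE.
have -> : last (l i) [seq l (i + Posz k.+1)%R | k <- iota 0 n] = l (i + Posz n)%R.
  case: n {lp1 pE} => [|n]; first by rewrite addr0.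
  by rewrite -[in iota _ _]addn1 iotaD map_cat cats1 last_rcons.
move=> /esym; rewrite (_ : (i + Posz n.+2)%R = (i + Posz n + 2)%R); first exact: l_straight.
by rewrite -addrA -PoszD addn2.
Qed.

Lemma line_geod i n : tree_geod (l i) (l (i + Posz n)%R) = mkseq (fun k => l (i + Posz k.+1)%R) n.
Proof. exact/esym/tree_geodE/line_simple. Qed.

Lemma line_dist i n : tree_dist (l i) (l (i + Posz n)%R) = n.
Proof. by rewrite /tree_dist /dist -/(tree_geod _ _) line_geod size_mkseq. Qed.

Lemma line_inj : injective l.
Proof.
suff H i n : l i = l (i + Posz n)%R -> n = 0.
  move=> i j; case: (lerP i j) => ij E.
    have := @H i `|(j - i)%R|%N; rewrite gez0_abs ?subr_ge0 // addrC subrK => /(_ E).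
    lia.
  have := @H j `|(i - j)%R|%N; rewrite gez0_abs ?subr_ge0 // ?ltW // addrC subrK => /(_ (esym E)).
  lia.
by move=> E; have := line_dist i n; rewrite -E tree_dist0.
Qed.

End Line.

Lemma line_geod_range (l : int -> X) i j x :
  (forall n, adj (l n) (l (n + 1)%R)) -> (forall n : int, l (n + 2)%R <> l n) ->
  x \in tree_geod (l i) (l j) -> exists n, x = l n.
Proof.
move=> la ls; have [ij|ij] := lerP i j.
  have -> : j = (i + Posz `|(j - i)%R|%N)%R by lia.
  by rewrite line_geod // => /mapP[k _ ->]; eexists.
pose l' n := l (- n)%R.
have la' n : adj (l' n) (l' (n + 1)%R).
  by rewrite adj_sym /l' -[X in adj _ (l X)](addrNK 1%R); have := la (- (n + 1))%R; rewrite opprD addrNK.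
have ls' n : l' (n + 2)%R <> l' n.
  by move=> /esym; rewrite /l' -{1}(opprK 2%R) -{1}[n](addrK 2%R) opprB addrC; exact: ls.
have := @line_geod l' la' ls' (- i)%R `|(i - j)%R|%N.
have -> : (- i + Posz `|(i - j)%R|%N)%R = (- j)%R by lia.
by rewrite /l' !opprK => -> /mapP[k _ ->]; eexists.
Qed.

Lemma act_zpow_fix g x k : act g x = x -> act (zpow g k) x = x.
Proof.
move=> gx; elim/int_ind: k => [|n IH|n IH]; first exact: act1.
  by rewrite -addn1 PoszD zpowS actM gx.
rewrite -addn1 PoszD zpowN zpowS; apply: (canLR (actK _)).
by rewrite actM gx -{2}IH zpowN actVK.
Qed.

(** Take a vertex whose distance to its image is minimal. The geodesic to the
    image, followed by its translates, is a line: a backtrack would either shorten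
    the displacement or invert an edge. *)
Lemma axis_exists g : (forall x, act g x <> x) ->
  exists l : int -> X, exists2 t : nat, 0 < t &
    [/\ forall n, adj (l n) (l (n + 1)%R), forall n : int, l (n + 2)%R <> l n &
        forall n, act g (l n) = l (n + Posz t)%R].
Proof.
move=> nofix.
have ex : exists n, `[< exists x, tree_dist x (act g x) = n >].
  have [x] := @tree_nonempty G X.
  by exists (tree_dist x (act g x)); apply/asboolP; exists x.
case: (ex_minnP ex) => t /asboolP[x xt] tmin {ex}.
have tmin' y : t <= tree_dist y (act g y) by apply: tmin; apply/asboolP; exists y.
have t0 : 0 < t by rewrite lt0n; apply/eqP => t0; apply: (nofix x); apply/esym/tree_dist_eq0; rewrite xt.
pose P := x :: tree_geod x (act g x); pose p i := nth x P i.
have sP : size P = t.+1 by rewrite /P /= -xt.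
have p0 : p 0 = x by [].
have pt : p t = act g x.
  have := geod_last (@tree_connected G X) x (act g x).
  by rewrite (last_nth x) -/(tree_geod _ _) -/P -[size _]/(tree_dist x (act g x)) xt.
have padj i : i < t -> adj (p i) (p i.+1).
  move=> it; have /(pathP x) := geod_path (@tree_connected G X) x (act g x).
  by apply; rewrite -[size _]/(tree_dist x (act g x)) xt.
have pne i j : i <= t -> j <= t -> p i = p j -> i = j.
  move=> it jt /eqP; rewrite nth_uniq ?sP //; first by move/eqP.
  exact: (geod_uniq (@tree_connected G X) x (act g x)).
have pdist i j : i + j <= t -> tree_dist (p i) (p (i + j)) <= j.
  elim: j => [|j IH] ij; first by rewrite addn0 tree_dist0.
  rewrite addnS in ij *; apply: leq_trans (tree_dist_triangle (p (i + j)) _ _) _.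
  by rewrite -[j.+1]addn1 leq_add ?IH ?tree_dist_edge ?padj // ltnW.
have [l lE] : exists l : int -> X, forall q (r : nat), r <= t ->
    l (q * Posz t + Posz r)%R = act (zpow g q) (p r).
  exists (fun n => act (zpow g (n %/ Posz t)%Z) (p `|(n %% Posz t)%Z|%N)) => q r.
  rewrite leq_eqVlt => /orP[/eqP->|rt].
    rewrite -[X in (_ + X)%R]mul1r -mulrDl mulzK ?modzMl //=; last by rewrite eqz_nat -lt0n.
    by rewrite zpowS actM p0 pt.
  rewrite divzMDl ?eqz_nat -?lt0n // divz_small ?addr0; last by rewrite /= ltz_nat.
  by rewrite modzMDl modz_small //= ltz_nat.
have decomp n : exists q, exists2 r : nat, r < t & n = (q * Posz t + Posz r)%R.
  exists (n %/ Posz t)%Z; exists `|(n %% Posz t)%Z|%N; last first.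
    by rewrite gez0_abs ?modz_ge0 ?eqz_nat -?lt0n // -divz_eq.
  by rewrite -ltz_nat gez0_abs ?modz_ge0 ?eqz_nat -?lt0n // ltz_pmod.
(* No backtrack at g x: its neighbours g (p 1) and p (t - 1) differ. *)
have inv : act g (p 1) <> p t.-1.
  move=> E; have [t1|t1] := leqP t 1.
    have te : t = 1 by apply/eqP; rewrite eqn_leq t1.
    move: E; rewrite te -[in p 1]te pt p0 => E.
    by apply: (@act_noinv G X g x (act g x)) => //; have := padj 0 t0; rewrite -pt p0 te.
  have := tmin' (p 1); rewrite E leqNgt => /negP; apply.
  have -> : t.-1 = 1 + (t - 2) by lia.
  by apply: leq_ltn_trans (pdist _ _ _) _; lia.
exists l; exists t => //; split=> n; have [q [r rt ->]] := decomp n.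
- by rewrite -addrA -PoszD addn1 (lE _ _ (ltnW rt)) (lE _ _ rt) act_adj padj.
- rewrite -addrA -PoszD addn2; have [rt2|rt2] := leqP r.+2 t.
    rewrite (lE _ _ (ltnW rt)) (lE _ _ rt2) => /act_inj /pne; rewrite rt2 (ltnW rt) => /(_ isT isT).
    lia.
  have -> : (q * Posz t + Posz r.+2 = (q + 1) * Posz t + Posz 1)%R by lia.
  rewrite (lE _ _ (ltnW rt)) (lE _ _ t0) zpowS actM => /act_inj.
  by have -> : r = t.-1 by lia.
- rewrite (_ : (_ + _ + _ = (q + 1) * Posz t + Posz r)%R); last by lia.
  by rewrite !(lE _ _ (ltnW rt)) -actM addrC zpowD.
Qed.

Lemma axis_zpow g (l : int -> X) (t : nat) k n :
  (forall n, act g (l n) = l (n + Posz t)%R) ->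
  act (zpow g k) (l n) = l (n + k * Posz t)%R.
Proof.
move=> gl; elim/int_ind: k n => [|k IH|k IH] n; first by rewrite act1 mul0r addr0.
  by rewrite -addn1 PoszD zpowS actM gl IH; congr l; lia.
apply: (@act_inj g); rewrite gl -actM -{1}[g]zpow1 -zpowD.
by rewrite (_ : (1 + - Posz k.+1 = - Posz k)%R) ?IH; [congr l|]; lia.
Qed.

(** A translation moves the vertices of its axis by unbounded distances when it
    is iterated, so no power of it fixes a vertex. *)
Lemma zpow_fix g k x : k != 0%R -> act (zpow g k) x = x -> exists y, act g y = y.
Proof.
move=> k0 kx; apply: contrapT => nofix.
have [|l [t t0 [la ls gl]]] := @axis_exists g; first by move=> y gy; apply: nofix; exists y.
pose K := (tree_dist (l 0%R) x).*2.+1; pose h := zpow g (k * k * Posz K)%R.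
have hx : act h x = x by rewrite /h -mulrA zpowM act_zpow_fix.
have := @tree_dist_triangle x (l 0%R) (act h (l 0%R)).
rewrite -{2}hx tree_dist_act (tree_dist_sym x) /h (axis_zpow _ _ gl).
rewrite -[(k * k)%R]gez0_abs; last by lia.
have kk0 : 0 < `|(k * k)%R|%N by rewrite absz_gt0 mulf_neq0.
rewrite -!PoszM line_dist //; apply/negP; rewrite -ltnNge addnn.
by apply: (@leq_trans K) => //; rewrite mulnAC leq_pmull // muln_gt0 kk0.
Qed.

(** If h and its conjugates have common powers then they have the same axis. A
    translate of the axis of h is the axis of a conjugate, and a common power f
    of both moves a vertex x of the translate and a vertex of the axis while
    keeping their distance D. The geodesic from f^-K x to f^K x passes through
    x, and away from its ends it runs along the axis; the vertex x is at
    distance more than D from the ends when K is large. *)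
Lemma invariant_line_of_commensurable h : (forall x, act h x <> x) ->
  (forall g, exists m k : int, m != 0%R /\ zpow (g * h * g^-1)%g m = zpow h k) ->
  invariant_line X.
Proof.
move=> nofix comm; have [l [t t0 [la ls hl]]] := axis_exists nofix.
suff H g n : exists m, act g (l n) = l m.
  exists l; split; [exact: line_inj|exact: la|] => g.
  apply/seteqP; split=> x.
    by move=> [_ [n _ <-] <-]; have [m ->] := H g n; exists m.
  move=> [n _ <-]; have [m E] := H g^-1%g n.
  by exists (l m); [exists m|rewrite -E actVK].
have [m0 [k0 [m0N E0]]] := comm g.
pose m := `|(m0 * m0)%R|%N; pose k := (k0 * m0)%R.
have m1 : 0 < m by rewrite absz_gt0 mulf_neq0.
have E K : zpow (g * h * g^-1)%g (Posz m * K)%R = zpow h (k * K)%R.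
  rewrite /m gez0_abs; last by nia.
  by rewrite -mulrA zpowM E0 -!zpowM mulrA.
pose x := act g (l n); pose D := tree_dist x (l 0%R); pose K := Posz D.+1.
have fx K' : act (zpow h (k * K')%R) x = act g (l (n + Posz m * K' * Posz t)%R).
  by rewrite -E zpow_conj /x -actM mulgVK actM (axis_zpow _ _ hl).
have fl K' : act (zpow h (k * K')%R) (l 0%R) = l (k * K' * Posz t)%R.
  by rewrite (axis_zpow _ _ hl) add0r.
have fd K' : tree_dist (act g (l (n + Posz m * K' * Posz t)%R)) (l (k * K' * Posz t)%R) = D.
  by rewrite -fx -fl tree_dist_act.
(* The vertex f^K x is at distance m K t from x, which exceeds D for K = D + 1. *)
have mKt : 0 < m * D.+1 * t by rewrite !muln_gt0 m1 t0.
have long : D < m * D.+1 * t by nia.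
have xin : x \in tree_geod (act g (l (n + Posz m * - K * Posz t)%R)) (act g (l (n + Posz m * K * Posz t)%R)).
  rewrite tree_geod_act map_f //.
  have -> : (n + Posz m * K * Posz t = (n + Posz m * - K * Posz t) + Posz (m * D.+1 * t + m * D.+1 * t))%R.
    by rewrite /K; lia.
  rewrite line_geod //; apply/mapP; exists (m * D.+1 * t).-1; first by rewrite mem_iota; lia.
  by congr l; rewrite prednK // /K; lia.
have tg y := @geod_triangle _ _ (@tree_connected G X) tree_cuts y.
have gdist := @geod_dist _ _ (@tree_connected G X) tree_cuts.
have [] := tg (l (k * - K * Posz t)%R) _ _ _ xin.
  move/gdist => [+ _]; rewrite -!/(tree_dist _ _) fd /x tree_dist_act.
  rewrite [X in tree_dist _ (l X)](_ : n = (n + Posz m * - K * Posz t + Posz (m * D.+1 * t))%R)%R.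
    by rewrite line_dist // leqNgt long.
  by rewrite /K; lia.
move/(tg (l (k * K * Posz t)%R)) => [/line_geod_range|]; first exact.
move/gdist => [_]; rewrite -!/(tree_dist _ _) (tree_dist_sym (l _)) fd /x tree_dist_act.
rewrite [X in tree_dist _ (l X)](_ : _ = (n + Posz (m * D.+1 * t))%R); last by rewrite /K; lia.
by rewrite line_dist // leqNgt long.
Qed.

End TreeGeometry.

(** * Generalized Baumslag-Solitar trees have the same elliptic elements *)

Section GBS.
Variable (G : groupType).
Implicit Types (X Y : gtree G) (g h : G).

Definition stab X (x : X) : set G := stabilizer (@act G X) x.

Lemma stab_act X (x : X) g : stab (act g x) = conj_set g (stab x).
Proof.
apply/seteqP; split=> h; rewrite /stab /stabilizer /conj_set /= => E.
  by rewrite actM actM E actK.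
by rewrite -{2}E -!actM !mulgA mulgV mul1g.
Qed.

Lemma stab_conj X (x : X) g h : stab x h -> stab (act g x) (g * h * g^-1)%g.
Proof. by rewrite stab_act /conj_set /= !mulgA mulVg mul1g mulgVK. Qed.

Lemma stab2_act X (x y : X) g :
  stab (act g x) `&` stab (act g y) = conj_set g (stab x `&` stab y).
Proof. by rewrite !stab_act. Qed.

Lemma stab_subgroup X (x : X) : subgroup (stab x).
Proof.
split=> [|g h gx hx|g gx]; rewrite /stab /stabilizer /=; first exact: act1.
  by rewrite actM hx gx.
by rewrite -{1}gx actK.
Qed.

Lemma stab_zpow X (x : X) g k : stab x g -> stab x (zpow g k).
Proof. exact: act_zpow_fix. Qed.

Lemma subgroup_meet (A B : set G) : subgroup A -> subgroup B -> subgroup (A `&` B).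
Proof.
move=> [A1 AM AV] [B1 BM BV]; split=> //.
  by move=> g h [Ag Bg] [Ah Bh]; split; [exact: AM|exact: BM].
by move=> g [Ag Bg]; split; [exact: AV|exact: BV].
Qed.

(** An equivalent form of being a generalized Baumslag-Solitar tree that does not
    mention edges, so that it is easily checked after a modification of the
    tree. *)
Definition commensurable_tree X : Prop :=
  (forall x : X, exists a, free_generator (stab x) a) /\
  forall x y : X, exists2 g, g != 1%g & stab x g /\ stab y g.

(** Without inversions, an element that preserves an edge fixes its endpoints. *)
Lemma edge_stabilizer X (u v : X) : adj u v ->
  stabilizer (@act_edge G X) [set u; v] = stab u `&` stab v.
Proof.
move=> uv; have uNv : u <> v by move=> E; move: uv; rewrite E adj_irr.
rewrite /stabilizer /act_edge; apply/seteqP; split=> g /=; last first.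
  by move=> [gu gv]; rewrite image_setU !image_set1 gu gv.
rewrite image_setU !image_set1 => E.
have gu : [set u; v] (act g u) by rewrite -E; left.
have gv : [set u; v] (act g v) by rewrite -E; right.
case: gu gv => /= [gu|gu] [gv|gv].
- by case: uNv; apply: (@act_inj G X g); rewrite gu gv.
- by [].
- by case: (act_noinv uv (conj gu gv)).
- by case: uNv; apply: (@act_inj G X g); rewrite gu gv.
Qed.

Lemma gbs_treeP X : gbs_tree X <-> commensurable_tree X.
Proof.
split=> [[gV gE]|[gV comm]].
  have gV' (x : X) : exists a, free_generator (stab x) a by exact: (infinite_cyclicP (stab x)).1 (gV x).
  split=> // x y; have [p] := tree_connected x y.
  elim/last_ind: p y => [|p z IH] y /=.
    move=> _ <-; have [a ga] := gV' x.
    by exists a; [exact: free_generator_neq1 ga|split; exact: free_generator_mem].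
  rewrite rcons_path last_rcons => /andP[pP lz] <-.
  have [g g1 [gx gl]] := IH _ pP erefl.
  have /infinite_cyclicP[b gb] : infinite_cyclic (stab (last x p) `&` stab z).
    by rewrite -edge_stabilizer //; apply: gE; exists (last x p), z.
  have [bl bz] := free_generator_mem gb.
  have [a ga] := gV' (last x p).
  have [k [m [k0 m0 E]]] := free_generator_meet ga gl bl g1 (free_generator_neq1 gb).
  exists (zpow g k); first exact: free_generator_torsion_free ga gl g1 k0.
  by split; [exact: stab_zpow|rewrite E; exact: stab_zpow].
split=> [x|_ [u [v [uv ->]]]]; first exact: (infinite_cyclicP (stab x)).2 (gV x).
rewrite edge_stabilizer //; apply/infinite_cyclicP; have [a ga] := gV u.
have [g g1 [gu gv]] := comm u v.
have [d iuv] : exists d, has_index (stab u) (stab u `&` stab v) d.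
  apply: (has_index_exists ga); first by apply: subgroup_meet; exact: stab_subgroup.
    by move=> h [].
  by exists g.
by eexists; exact: has_index_gen iuv ga.
Qed.

(** A vertex stabilizer of a generalized Baumslag-Solitar tree is commensurable
    with all its conjugates. If its generator fixed no vertex of another tree X,
    its axis in X would therefore be preserved by the whole group. *)
Lemma gbs_stab_elliptic X Y (y : Y) c : ~ invariant_line X -> commensurable_tree Y ->
  stab y c -> exists x : X, stab x c.
Proof.
move=> noline [gY comm] yc; apply: contrapT => nofix; apply: noline.
have c1 : c != 1%g.
  apply/eqP => c1; apply: nofix; have [x] := @tree_nonempty G X.
  by exists x; rewrite c1; exact: act1.
apply: (@invariant_line_of_commensurable G X c) => [x xc|g].
  by apply: nofix; exists x.
have [k k1 [ky kgy]] := comm y (act g y).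
have [a ga] := gY y; have [b gb] := gY (act g y).
have [p [q [p0 q0 E1]]] := free_generator_meet ga yc ky c1 k1.
have gc1 : (g * c * g^-1)%g != 1%g.
  rewrite -(inj_eq (@mulIg _ g)) mulgVK mul1g -[X in _ != X]mulg1.
  by rewrite (inj_eq (@mulgI _ g)).
have [r [s [r0 s0 E2]]] := free_generator_meet gb (stab_conj g yc) kgy gc1 k1.
exists (r * q)%R, (p * s)%R; split; first by rewrite mulf_neq0.
by rewrite !zpowM E2 E1 -!zpowM mulrC.
Qed.

(** Compare a with a generator c of a vertex stabilizer of Y. Since c is elliptic
    in X by [gbs_stab_elliptic], the elements a and c have a common nontrivial
    power, which fixes a vertex of Y. *)
Lemma gbs_elliptic_transfer X Y (x : X) a : ~ invariant_line X ->
  commensurable_tree X -> commensurable_tree Y -> stab x a ->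
  exists y : Y, stab y a.
Proof.
move=> noline cX cY xa; have [->|a1] := eqVneq a 1%g.
  by have [y] := @tree_nonempty G Y; exists y; exact: act1.
have [y] := @tree_nonempty G Y; have [c gc] := cY.1 y.
have yc := free_generator_mem gc; have c1 := free_generator_neq1 gc.
have [x' x'c] := gbs_stab_elliptic noline cY yc.
have [k k1 [kx kx']] := cX.2 x x'.
have [b gb] := cX.1 x; have [b' gb'] := cX.1 x'.
have [p [q [p0 q0 E1]]] := free_generator_meet gb xa kx a1 k1.
have [r [s [r0 s0 E2]]] := free_generator_meet gb' x'c kx' c1 k1.
apply: (@zpow_fix G Y a (p * s)%R y); first by rewrite mulf_neq0.
rewrite zpowM E1 -zpowM mulrC zpowM -E2 -zpowM; exact: stab_zpow.
Qed.

End GBS.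

(** * Collapses and expansions *)

Section Reach.
Variables (V : eqType) (e : rel V).

Definition reach x y : Prop := exists2 p, path e x p & last x p = y.

Lemma reach_refl x : reach x x. Proof. by exists [::]. Qed.

Lemma reach_edge x y : e x y -> reach x y.
Proof. by move=> xy; exists [:: y] => //=; rewrite xy. Qed.

Lemma reach_trans y x z : reach x y -> reach y z -> reach x z.
Proof.
by move=> [p pP <-] [q qP <-]; exists (p ++ q); rewrite ?cat_path ?pP ?last_cat.
Qed.

End Reach.

Lemma reach_map (V V' : eqType) (e : rel V) (e' : rel V') (f : V -> V') x y :
  (forall u v, e u v -> reach e' (f u) (f v)) -> reach e x y -> reach e' (f x) (f y).
Proof.
move=> H [p pP <-]; elim: p x pP => [|a p IH] x /=; first by move=> _; exact: reach_refl.
by move=> /andP[/H xa /IH]; exact: reach_trans.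
Qed.

Section Collapse.
Variables (G : groupType) (X : gtree G) (r : X -> X).
Hypothesis r_idem : forall v, r (r v) = r v.
Hypothesis r_adj : forall v, r v = v \/ adj v (r v).
Hypothesis r_act : forall g v, r (act g v) = act g (r v).

Local Notation collapse_vertex := {v : X | r v == v}.
Implicit Types p q : collapse_vertex.

(** The edges from v to r v are collapsed; they form stars centered at the
    fixed points of r, because r is idempotent. *)
Definition retract (v : X) : collapse_vertex := exist _ (r v) (introT eqP (r_idem v)).

Lemma retractE p : retract (val p) = p.
Proof. by case: p => v vr; exact/val_inj/eqP. Qed.

Definition collapse_adj : rel collapse_vertex := fun p q =>
  (p != q) && `[< exists u v : X, [/\ adj u v, retract u = p & retract v = q] >].

Lemma collapse_act_subproof g p : r (act g (val p)) == act g (val p).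
Proof. by rewrite r_act (eqP (svalP p)). Qed.

Definition collapse_act g p : collapse_vertex :=
  exist _ (act g (val p)) (collapse_act_subproof g p).

Lemma retract_act g v : retract (act g v) = collapse_act g (retract v).
Proof. by apply/val_inj; rewrite /= r_act. Qed.

(** The edge from w to r w is collapsed, hence is not the edge uv, so that every
    cut of X at a surviving edge descends to the collapsed graph. *)
Lemma cut_retract s u v w : cut_at (@adj G X) s u v -> r u != r v -> s (r w) = s w.
Proof.
move=> [_ sP] uv; case: (r_adj w) => [->//|ww].
apply/eqP; rewrite eq_sym; apply: contraT => /(sP _ _ ww).
by case/orP=> /andP[/eqP wu /eqP wv]; move: uv; rewrite -wu -wv r_idem eqxx.
Qed.

(** By [cut_retract] the edge u'v' crosses the cut at uv, which is crossed by one
    edge only. *)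
Lemma retract_edge_inj u v u' v' : adj u v -> adj u' v' -> r u != r v ->
  r u' = r u -> r v' = r v -> u' = u /\ v' = v.
Proof.
move=> uv uv' ne ru rv; have [s sP] := tree_cuts uv.
have E w := cut_retract w sP ne; have [suv sP'] := sP.
have := sP' _ _ uv'; rewrite -(E u') -(E v') ru rv !E => /(_ suv).
case/orP=> /andP[/eqP uu /eqP vv] //.
by move: ne; rewrite -ru uu eqxx.
Qed.

Lemma collapse_sym : symmetric collapse_adj.
Proof.
move=> p q; rewrite /collapse_adj eq_sym; congr (_ && _).
by apply/asbool_equiv_eq; split=> -[u [v [uv pu qv]]]; exists v, u; rewrite adj_sym.
Qed.

Lemma collapse_irr : irreflexive collapse_adj.
Proof. by move=> p; rewrite /collapse_adj eqxx. Qed.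

Lemma collapse_nonempty : inhabited collapse_vertex.
Proof. by have [x] := @tree_nonempty G X; exact: (inhabits (retract x)). Qed.

Lemma collapse_edge u v : adj u v -> r u != r v -> collapse_adj (retract u) (retract v).
Proof.
by move=> uv ne; apply/andP; split=> //; apply/asboolP; exists u, v.
Qed.

Lemma collapse_connected p q : reach collapse_adj p q.
Proof.
rewrite -(retractE p) -(retractE q); apply: (@reach_map X _ (@adj G X)).
  move=> u v uv; have [E|ne] := eqVneq (r u) (r v).
    rewrite (_ : retract v = retract u); first exact: reach_refl.
    by apply/val_inj; rewrite /= E.
  by apply: reach_edge; exact: collapse_edge.
exact: tree_connected.
Qed.

Lemma collapse_cuts p q : collapse_adj p q -> exists s, cut_at collapse_adj s p q.
Proof.
case/andP=> pq /asboolP[u [v [uv pE qE]]]; have [s sP] := tree_cuts uv.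
have ne : r u != r v.
  by apply: contraNneq pq => E; rewrite -pE -qE; apply/eqP/val_inj.
have E w : s (val (retract w)) = s w by rewrite /= (cut_retract _ sP ne).
have [suv sP'] := sP.
exists (fun x => s (val x)); split; first by rewrite -pE -qE !E.
move=> x y /andP[_ /asboolP[u' [v' [uv' <- <-]]]]; rewrite !E => /(sP' _ _ uv').
by case/orP=> /andP[/eqP-> /eqP->]; rewrite /same_edge pE qE !eqxx ?orbT.
Qed.

Lemma collapse_act1 p : collapse_act 1%g p = p.
Proof. by apply/val_inj; rewrite /= act1. Qed.

Lemma collapse_actM g h p : collapse_act (g * h)%g p = collapse_act g (collapse_act h p).
Proof. by apply/val_inj; rewrite /= actM. Qed.

Lemma collapse_act_inj g : injective (collapse_act g).
Proof. by move=> p q /(congr1 val) /= /act_inj /val_inj. Qed.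

Lemma collapse_act_adj g p q :
  collapse_adj (collapse_act g p) (collapse_act g q) = collapse_adj p q.
Proof.
rewrite /collapse_adj (inj_eq (@collapse_act_inj g)); congr (_ && _).
apply/asbool_equiv_eq; split=> -[u [v [uv pE qE]]].
  exists (act g^-1%g u), (act g^-1%g v); rewrite act_adj !retract_act pE qE.
  by rewrite -!collapse_actM mulVg !collapse_act1.
by exists (act g u), (act g v); rewrite act_adj !retract_act pE qE.
Qed.

Lemma collapse_noinv g p q : collapse_adj p q ->
  ~ (collapse_act g p = q /\ collapse_act g q = p).
Proof.
case/andP=> pq /asboolP[u [v [uv pE qE]]] [gp gq].
have ne : r u != r v by apply: contraNneq pq => E; rewrite -pE -qE; apply/eqP/val_inj.
have gvu : adj (act g v) (act g u) by rewrite act_adj adj_sym.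
have [] := @retract_edge_inj u v (act g v) (act g u) uv gvu ne.
- by rewrite r_act -[r v]/(val (retract v)) qE -[RHS]/(val (retract u)) pE -gq.
- by rewrite r_act -[r u]/(val (retract u)) pE -[RHS]/(val (retract v)) qE -gp.
by move=> gv gu; apply: (act_noinv uv (conj gu gv)).
Qed.

Definition collapse : gtree G :=
  GTree collapse_sym collapse_irr collapse_nonempty collapse_connected
    (acyclic_of_cuts collapse_cuts) collapse_act1 collapse_actM collapse_act_adj
    collapse_noinv.

Lemma collapse_stab (p : collapse) : stab p = stab (val p).
Proof.
apply/seteqP; split=> g /=; first by move/(congr1 val).
by move=> gp; apply/val_inj.
Qed.

(** By [retract_edge_inj], an element that fixes both ends of the image of an edge
    fixes both ends of that edge. *)
Lemma collapse_edge_stab u v : adj u v -> r u != r v ->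
  stab (retract u : collapse) `&` stab (retract v : collapse) `<=` stab u `&` stab v.
Proof.
move=> uv ne g; rewrite !collapse_stab /= => -[gu gv].
have guv : adj (act g u) (act g v) by rewrite act_adj.
apply: (@retract_edge_inj u v) => //; rewrite r_act; [exact: gu|exact: gv].
Qed.

End Collapse.

Section Expand.
Variables (G : groupType) (X : gtree G) (W : choiceType) (actW : G -> W -> W).
Variables (f : W -> X) (att : X -> X -> option W).
Hypothesis actW1 : forall w, actW 1%g w = w.
Hypothesis actWM : forall g h w, actW (g * h)%g w = actW g (actW h w).
Hypothesis f_act : forall g w, f (actW g w) = act g (f w).
Hypothesis att_f : forall y z w, att y z = Some w -> f w = y.
Hypothesis att_act : forall g y z, att (act g y) (act g z) = omap (actW g) (att y z).

Local Notation expand_vertex := (X + W)%type.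
Implicit Types p q : expand_vertex.

(** Each vertex y is blown up into a star with center y and leaves the elements of
    W above y; the edge from y to z is attached to the leaf [att y z], if any,
    and to the center otherwise. *)
Definition attach (y z : X) : expand_vertex := if att y z is Some w then inr w else inl y.

Definition expand_proj p : X := match p with inl y => y | inr w => f w end.

Definition expand_act g p : expand_vertex :=
  match p with inl y => inl (act g y) | inr w => inr (actW g w) end.

Definition expand_adj : rel expand_vertex := fun p q =>
  `[< [\/ exists2 w, p = inr w & q = inl (f w), exists2 w, p = inl (f w) & q = inr w |
      exists y z, [/\ adj y z, p = attach y z & q = attach z y]] >].

Lemma expand_proj_attach y z : expand_proj (attach y z) = y.
Proof. by rewrite /attach; case E : (att y z) => [w|] //=; exact: att_f E. Qed.

Lemma attach_act g y z : attach (act g y) (act g z) = expand_act g (attach y z).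
Proof. by rewrite /attach att_act; case: (att y z). Qed.

Lemma expand_sym : symmetric expand_adj.
Proof.
move=> p q; apply/asbool_equiv_eq; split; case=> [[w pE qE]|[w pE qE]|[y [z [yz pE qE]]]].
- by apply: Or32; exists w.
- by apply: Or31; exists w.
- by apply: Or33; exists z, y; rewrite adj_sym.
- by apply: Or32; exists w.
- by apply: Or31; exists w.
- by apply: Or33; exists z, y; rewrite adj_sym.
Qed.

Lemma expand_irr : irreflexive expand_adj.
Proof.
move=> p; apply/asboolP; case=> [[w ->]|[w ->]|[y [z [yz pE qE]]]] //.
have := expand_proj_attach y z; rewrite -pE qE expand_proj_attach => zy.
by move: yz; rewrite zy adj_irr.
Qed.

Lemma expand_nonempty : inhabited expand_vertex.
Proof. by have [x] := @tree_nonempty G X; exact: (inhabits (inl x)). Qed.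

Lemma expand_adj_new w : expand_adj (inr w) (inl (f w)).
Proof. by apply/asboolP; apply: Or31; exists w. Qed.

Lemma expand_adj_old y z : adj y z -> expand_adj (attach y z) (attach z y).
Proof. by move=> yz; apply/asboolP; apply: Or33; exists y, z. Qed.

Lemma expand_connected p q : reach expand_adj p q.
Proof.
have hub p' : reach expand_adj p' (inl (expand_proj p')) /\
    reach expand_adj (inl (expand_proj p')) p'.
  case: p' => [y|w]; first by split; exact: reach_refl.
  split; apply: reach_edge; last rewrite expand_sym; exact: expand_adj_new.
have hub' y z : reach expand_adj (attach y z) (inl y) /\
    reach expand_adj (inl y) (attach y z).
  by rewrite -{2 3}(expand_proj_attach y z); exact: hub.
apply: reach_trans (hub p).1 (reach_trans _ (hub q).2).
apply: (@reach_map X expand_vertex (@adj G X) _ inl); last exact: tree_connected.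
move=> u v uv; apply: reach_trans (hub' u v).2 (reach_trans _ (hub' v u).1).
by apply: reach_edge; exact: expand_adj_old.
Qed.

(** An old edge keeps its cut. The edge between a leaf w and its center separates
    w, together with the branches attached to w, from everything else. *)
Lemma expand_cuts p q : expand_adj p q -> exists s, cut_at expand_adj s p q.
Proof.
have new w : exists s, cut_at expand_adj s (inr w) (inl (f w)).
  (* The predicate far says that the branch at f w containing v is attached to w. *)
  pose far v := exists a, [/\ adj (f w) a, att (f w) a = Some w & a \in tree_geod (f w) v].
  pose s p' := (p' == inr w) || `[< far (expand_proj p') >].
  have far0 v : v = f w -> ~ far v.
    by move=> -> [a [_ _]]; rewrite tree_geod_refl.
  have sfw a : adj (f w) a -> s (attach a (f w)) = s (attach (f w) a).
    move=> wa; rewrite /s !expand_proj_attach.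
    have -> : (attach a (f w) == inr w) = false.
      apply: contraTF wa => /eqP/(congr1 expand_proj).
      by rewrite expand_proj_attach /= => ->; rewrite adj_irr.
    rewrite (asboolF (far0 _ erefl)) orbF /=.
    apply/asboolP/eqP => [[b [wb attb]]|E].
      by rewrite tree_geod_adj // inE => /eqP <-; rewrite /attach attb.
    exists a; rewrite tree_geod_adj // inE eqxx; split=> //.
    by move: E; rewrite /attach; case: (att _ _) => // w' [->].
  exists s; split.
    by rewrite /s eqxx /=; rewrite (asboolF (far0 _ erefl)).
  have main p' q' : s p' != s q' -> (exists2 w', p' = inr w' & q' = inl (f w')) ->
      p' = inr w /\ q' = inl (f w).
    move=> + [w' pE qE]; rewrite {}pE {}qE /s /=.
    by have [[->]//|_] := eqVneq (inr w' : expand_vertex) (inr w); rewrite eqxx.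
  move=> p' q' /asboolP[E|[w' qE pE]|[y [z [yz pE qE]]]] spq.
  - by have [-> ->] := main _ _ spq E; rewrite /same_edge !eqxx.
  - have [||-> ->] := @main q' p'; [by rewrite eq_sym|by exists w'|].
    by rewrite /same_edge !eqxx orbT.
  - case/eqP: spq; rewrite {}pE {}qE.
    have [yw|yw] := eqVneq y (f w); first by rewrite yw in yz *; rewrite sfw.
    have [zw|zw] := eqVneq z (f w).
      by rewrite zw in yz *; rewrite sfw // adj_sym.
    have notw a b : a != f w -> (attach a b == inr w) = false.
      move=> aw; apply: contraNF aw => /eqP/(congr1 expand_proj).
      by rewrite expand_proj_attach => ->.
    rewrite /s !notw //= !expand_proj_attach; apply/asbool_equiv_eq.
    split=> -[a [wa attw ain]]; exists a; split=> //.
      exact: tree_geod_branch wa yz yw zw ain.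
    by apply: tree_geod_branch wa _ zw yw ain; rewrite adj_sym.
case/asboolP=> [[w -> ->]|[w -> ->]|[y [z [yz -> ->]]]].
- exact: new.
- have [s [ss sP]] := new w; exists s; split; first by rewrite eq_sym.
  by move=> a b ab sab; have := sP a b ab sab; rewrite /same_edge orbC.
have [s [syz sP]] := tree_cuts yz.
exists (fun p' => s (expand_proj p')); split; first by rewrite !expand_proj_attach.
move=> a b /asboolP[[w -> ->]|[w -> ->]|[u [v [uv -> ->]]]]; rewrite /= ?eqxx //.
rewrite !expand_proj_attach => /(sP _ _ uv).
by case/orP=> /andP[/eqP-> /eqP->]; rewrite /same_edge !eqxx ?orbT.
Qed.

Lemma expand_act1 p : expand_act 1%g p = p.
Proof. by case: p => x /=; rewrite ?act1 ?actW1. Qed.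

Lemma expand_actM g h p : expand_act (g * h)%g p = expand_act g (expand_act h p).
Proof. by case: p => x /=; rewrite ?actM ?actWM. Qed.

Lemma expand_act_adj g p q :
  expand_adj (expand_act g p) (expand_act g q) = expand_adj p q.
Proof.
have H h a b : expand_adj a b -> expand_adj (expand_act h a) (expand_act h b).
  case/asboolP=> [[w -> ->]|[w -> ->]|[y [z [yz -> ->]]]] /=.
  - by rewrite -f_act expand_adj_new.
  - by rewrite -f_act expand_sym expand_adj_new.
  - by rewrite -!attach_act expand_adj_old // act_adj.
apply/idP/idP; last exact: H.
by move/(H g^-1%g); rewrite -!expand_actM mulVg !expand_act1.
Qed.

Lemma expand_noinv g p q : expand_adj p q -> ~ (expand_act g p = q /\ expand_act g q = p).
Proof.
case/asboolP=> [[w -> ->]|[w -> ->]|[y [z [yz -> ->]]]] /=; try by case.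
rewrite -!attach_act => -[/(congr1 expand_proj) E1 /(congr1 expand_proj) E2].
by move: E1 E2; rewrite !expand_proj_attach => E1 E2; exact: (act_noinv yz (conj E1 E2)).
Qed.

Definition expand : gtree G :=
  GTree expand_sym expand_irr expand_nonempty expand_connected
    (acyclic_of_cuts expand_cuts) expand_act1 expand_actM expand_act_adj expand_noinv.

Lemma expand_stab_old (y : X) : stab (inl y : expand) = stab y.
Proof. by apply/seteqP; split=> g; [case|move=> /= gy; rewrite /stab /stabilizer /= gy]. Qed.

Lemma expand_stab_new w : stab (inr w : expand) = [set g | actW g w = w].
Proof. by apply/seteqP; split=> g; [case|move=> /= gy; rewrite /stab /stabilizer /= gy]. Qed.

End Expand.

(** * Counting edge orbits against vertex orbits *)

Section Counting.
Variables (G : groupType) (E : set G).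

(** Morphisms from G to Z/2 that kill E. When E consists of the elliptic elements
    they form the first cohomology group of the quotient graph modulo 2. *)
Definition elliptic_hom : Type :=
  {phi : G -> bool | (forall g h, phi (g * h)%g = phi g (+) phi h) /\
                     forall g, E g -> phi g = false}.

Lemma elliptic_hom0 : inhabited elliptic_hom.
Proof. by split; exists (fun=> false). Qed.

Lemma elliptic_hom_inj (a b : elliptic_hom) : sval a =1 sval b -> a = b.
Proof.
case: a b => a aP [b bP] /= /funext ab; move: aP bP; rewrite ab => aP bP.
by rewrite (Prop_irrelevance aP bP).
Qed.

Variable Y : gtree G.
Implicit Types (x y u v : Y) (psi : Y -> bool) (g h : G).

(** The function psi itself need not be invariant. *)
Definition invariant_coboundary psi : Prop := forall g u v, adj u v ->
  psi (act g u) (+) psi (act g v) = psi u (+) psi v.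

(** The difference between psi and its translate by g has zero coboundary, hence
    is constant. *)
Lemma invariant_coboundary_shift psi g x y : invariant_coboundary psi ->
  psi (act g x) (+) psi x = psi (act g y) (+) psi y.
Proof.
move=> eq; have [p pP <-] := tree_connected x y.
elim: p x pP => //= a p IH x /andP[xa pP]; rewrite -IH //.
have := eq g x a xa.
by case: (psi (act g x)); case: (psi x); case: (psi (act g a)); case: (psi a).
Qed.

Definition edge_equiv (d e : Y * Y) : Prop :=
  exists g, same_edge (act g d.1) (act g d.2) e.1 e.2.

Variables (m n : nat) (e : 'I_m -> Y * Y) (x : 'I_n -> Y).
Hypothesis e_adj : forall i, adj (e i).1 (e i).2.

(** Given a value at a base vertex, an invariant function on the edges integrates
    to a function psi on the vertices. Its translates differ from psi by
    constants, which define a morphism G -> Z/2, and psi is determined by this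
    morphism and by one value in each vertex orbit. *)
Lemma edges_to_vertices :
  (forall g, E g -> exists y, stab y g) ->
  (forall i j, edge_equiv (e i) (e j) -> i = j) ->
  (forall y, exists i g, act g (x i) = y) ->
  exists F : {ffun 'I_m -> bool} * bool -> elliptic_hom * {ffun 'I_n -> bool}, injective F.
Proof.
move=> EY e_indep x_cover; have [x0] := @tree_nonempty G Y.
pose ch (c : {ffun 'I_m -> bool}) u v := `[< exists2 i, c i & edge_equiv (e i) (u, v) >].
have ch_sym c u v : ch c u v = ch c v u.
  have sw a b p q : same_edge a b p q = same_edge a b q p :> bool.
    by rewrite /same_edge orbC andbC [X in _ || X]andbC.
  by apply/asbool_equiv_eq; split=> -[i ci [g gi]]; exists i => //; exists g; rewrite sw.
have ch_act c g u v : ch c (act g u) (act g v) = ch c u v.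
  apply/asbool_equiv_eq; split=> -[i ci [h /= hi]]; exists i => //.
    exists (g^-1 * h)%g; rewrite !actM /=.
    by move: hi => /orP[] /andP[/eqP<- /eqP<-]; rewrite !actK /same_edge !eqxx ?orbT.
  exists (g * h)%g; rewrite !actM /=.
  by move: hi => /orP[] /andP[/eqP-> /eqP->]; rewrite /same_edge !eqxx ?orbT.
have /choice[Psi PsiP] : forall cb : {ffun 'I_m -> bool} * bool, exists f : Y -> bool,
    f x0 = cb.2 /\ forall u v, adj u v -> f u (+) f v = ch cb.1 u v.
  move=> [c b] /=.
  have [f f0 fE] := integrate (@adj_sym G Y) (@tree_connected G Y) (@tree_cuts G Y)
    x0 b (ch_sym c).
  by exists f.
have PsiE cb : invariant_coboundary (Psi cb).
  by move=> g u v uv; rewrite !(PsiP cb).2 ?act_adj // ch_act.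
pose phi cb g := Psi cb (act g x0) (+) Psi cb x0.
have phiP cb : (forall g h, phi cb (g * h)%g = phi cb g (+) phi cb h) /\
    forall g, E g -> phi cb g = false.
  split=> [g h|g /EY[y gy]].
    have := @invariant_coboundary_shift (Psi cb) g x0 (act h x0) (PsiE cb); rewrite /phi actM => ->.
    by rewrite -addbA; congr (_ (+) _); rewrite addbA addbb.
  by rewrite /phi (@invariant_coboundary_shift _ g x0 y) // gy addbb.
exists (fun cb => (exist _ (phi cb) (phiP cb), [ffun i => Psi cb (x i)])).
move=> cb cb' /= [phiE /ffunP xE].
have PE : Psi cb =1 Psi cb'.
  move=> y; have [i [g <-]] := x_cover y.
  have := congr1 (@^~ g) phiE; rewrite /phi.
  rewrite !(@invariant_coboundary_shift _ g x0 (x i)) //.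
  by have := xE i; rewrite !ffunE => -> /addIb.
case: cb cb' PE {phiE xE} => c b [c' b'] PE; congr (_, _); last first.
  by have := (PsiP (c, b)).1; rewrite PE (PsiP (c', b')).1.
apply/ffunP => i; have := (PsiP (c, b)).2 _ _ (e_adj i).
rewrite !PE (PsiP (c', b')).2 //=.
have chi d : ch d (e i).1 (e i).2 = d i.
  apply/asboolP/idP => [[j dj]|di]; first by rewrite -surjective_pairing => /e_indep <-.
  by exists i => //; exists 1%g; rewrite !act1 /same_edge !eqxx.
by rewrite !chi.
Qed.

(** Conversely, a morphism G -> Z/2 that kills the vertex stabilizers and a value
    for each vertex orbit define a function psi that is shifted by the morphism
    under translation. It is determined by its coboundary, which is invariant,
    and by its value at a base vertex. *)
Lemma vertices_to_edges :
  (forall g y, stab y g -> E g) ->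
  (forall u v, adj u v -> exists i, edge_equiv (e i) (u, v)) ->
  (forall i j g, act g (x i) = x j -> i = j) ->
  exists F : elliptic_hom * {ffun 'I_n -> bool} -> {ffun 'I_m -> bool} * bool, injective F.
Proof.
move=> EY e_cover x_indep; have [x0] := @tree_nonempty G Y.
pose O y : set Y := orbit_of (@act G Y) y.
have OE g y : O (act g y) = O y.
  apply/seteqP; split=> _ [h _ <-].
    by exists (h * g)%g; rewrite // actM.
  by exists (h * g^-1)%g => //; rewrite actM actK.
pose rho y := xget x0 (O y).
have rhoE g y : rho (act g y) = rho y by rewrite /rho OE.
have /choice[gam gamP] : forall y, exists g, act g (rho y) = y.
  move=> y.
  have : O y (rho y) by apply: (@xgetI _ _ _ y); exists 1%g => //; exact: act1.
  by move=> [g _ gy]; exists g^-1%g; rewrite -gy actK.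
(* The value 0 is used on orbits that are not among those of the x i. *)
pose fh (f : {ffun 'I_n -> bool}) y := `[< exists2 i, f i & O (x i) = O y >].
pose psi (a : elliptic_hom * {ffun 'I_n -> bool}) y := fh a.2 y (+) sval a.1 (gam y).
have psi_act a g y : psi a (act g y) = psi a y (+) sval a.1 g.
  rewrite /psi /fh OE -addbA; congr (_ (+) _).
  have [phiM phiE] := svalP a.1.
  have phiV h : sval a.1 h^-1%g = sval a.1 h.
    have : sval a.1 (h * h^-1)%g = false.
      by rewrite mulgV; apply: phiE; apply: (EY _ x0); exact: act1.
    by rewrite phiM; case: (sval a.1 h); case: (sval a.1 _).
  have : sval a.1 ((gam (act g y))^-1 * (g * gam y))%g = false.
    apply: phiE; apply: (EY _ (rho y)).
    by rewrite /stab /stabilizer /= !actM gamP -{2}[act g y]gamP rhoE actK.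
  rewrite !phiM phiV.
  by case: (sval a.1 (gam _)); case: (sval a.1 g); case: (sval a.1 (gam _)).
have psi_eq a : invariant_coboundary (psi a).
  by move=> g u v _; rewrite !psi_act addbACA addbb addbF.
exists (fun a => ([ffun i => psi a (e i).1 (+) psi a (e i).2], psi a x0)).
move=> a a' [/ffunP eE x0E].
have PE : psi a =1 psi a'.
  move=> y; have [p pP <-] := tree_connected x0 y.
  elim/last_ind: p pP => //= p z IH; rewrite rcons_path last_rcons => /andP[pP lz].
  have [i [g gi]] := e_cover _ _ lz.
  have key b : psi b (last x0 p) (+) psi b z = psi b (e i).1 (+) psi b (e i).2.
    rewrite -(psi_eq b g _ _ (e_adj i)).
    by case/orP: gi => /andP[/eqP /= -> /eqP ->] //; rewrite addbC.
  have := eE i; rewrite !ffunE -!key IH // => H.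
  by apply: (@addbI (psi a' (last x0 p))).
have phiE : a.1 = a'.1.
  apply: elliptic_hom_inj => g; have := PE (act g x0); rewrite !psi_act PE.
  by move/addbI.
case: a a' PE phiE {eE x0E psi_eq psi_act} => a f [a' f'] PE /= aE; rewrite aE in PE *; congr (_, _).
apply/ffunP => i; have := PE (x i); rewrite /psi /= => /addIb.
have fhi d : fh d (x i) = d i.
  apply/asboolP/idP => [[j dj ji]|di]; last by exists i.
  have : O (x j) (x i) by rewrite ji; exists 1%g => //; exact: act1.
  by move=> [g _ /x_indep <-].
by rewrite !fhi.
Qed.

End Counting.

(** The factor H embeds in a finite type, so it is finite and can be cancelled
    from an inequality of cardinals. *)
Lemma cancel_factor (H : Type) (T A B : finType) (i : H -> T) (F : H * A -> H * B) :
  inhabited H -> injective i -> injective F -> #|A| <= #|B|.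
Proof.
move=> [h0] i_inj F_inj; pose S := {t : T | `[< exists h, i h = t >]}.
have /choice[k kP] : forall s : S, exists h, i h = val s.
  by case=> t /= /asboolP.
have iS h : `[< exists h', i h' = i h >] by apply/asboolP; exists h.
pose j h : S := exist _ (i h) (iS h).
have kj h : k (j h) = h by apply: i_inj; rewrite kP.
have k_inj : injective k by move=> s s' ss; apply/val_inj; rewrite /= -!kP ss.
pose F' (p : S * A) : S * B := (j (F (k p.1, p.2)).1, (F (k p.1, p.2)).2).
have F'_inj : injective F'.
  move=> [s a] [s' a'] [] /i_inj E1 E2.
  have := F_inj (k s, a) (k s', a'); rewrite [F _]surjective_pairing E1 E2 -surjective_pairing.
  by move=> /(_ erefl) [/k_inj -> ->].
have := leq_card _ F'_inj; rewrite !card_prod leq_pmul2l //.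
by apply/card_gt0P; exists (j h0).
Qed.

(** * Comparison of two trees *)

Section Representatives.
Variables (G : groupType) (Y : gtree G).

Lemma set2_same_edge (u v p q : Y) : adj p q -> [set u; v] = [set p; q] -> same_edge u v p q.
Proof.
move=> pq E; have : [set u; v] p by rewrite E; left.
have : [set u; v] q by rewrite E; right.
have pNq : p <> q by move=> pE; move: pq; rewrite pE adj_irr.
move=> /= [qE|qE] [pE|pE]; try by case: pNq; rewrite pE qE.
  by rewrite /same_edge pE qE !eqxx orbT.
by rewrite /same_edge pE qE !eqxx.
Qed.

Lemma edge_orbitP (d e : Y * Y) : adj e.1 e.2 ->
  orbit_of (@act_edge G Y) [set d.1; d.2] = orbit_of (@act_edge G Y) [set e.1; e.2] <->
  edge_equiv d e.
Proof.
move=> e_adj; have actE g (u v : Y) : act_edge g [set u; v] = [set act g u; act g v].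
  by rewrite /act_edge image_setU !image_set1.
split=> [E|[g ge]].
  have : orbit_of (@act_edge G Y) [set d.1; d.2] [set e.1; e.2].
    by rewrite E; exists 1%g => //; rewrite actE !act1.
  by move=> [g _]; rewrite actE => /set2_same_edge; exists g; auto.
have {}ge : act_edge g [set d.1; d.2] = [set e.1; e.2].
  by rewrite actE; case/orP: ge => /andP[/eqP-> /eqP->]; rewrite // setUC.
have actM' h k (s : set Y) : act_edge (h * k)%g s = act_edge h (act_edge k s).
  rewrite /act_edge image_comp; apply: eq_imagel => x _ /=; exact: actM.
apply/seteqP; split=> _ [h _ <-].
  exists (h * g^-1)%g => //; rewrite -ge -actM' mulgVK //.
by exists (h * g)%g; rewrite // actM' ge.
Qed.

Lemma vertex_orbitP (x y : Y) :
  orbit_of (@act G Y) x = orbit_of (@act G Y) y <-> exists g, act g x = y.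
Proof.
split=> [E|[g <-]].
  have : orbit_of (@act G Y) x y by rewrite E; exists 1%g => //; exact: act1.
  by move=> [g _]; exists g.
apply/seteqP; split=> _ [h _ <-].
  by exists (h * g^-1)%g => //; rewrite actM actK.
by exists (h * g)%g; rewrite // actM.
Qed.

Lemma independent_edges m : `I_m #<= edge_orbits Y ->
  exists e : 'I_m -> Y * Y, (forall i, adj (e i).1 (e i).2) /\
    forall i j, edge_equiv (e i) (e j) -> i = j.
Proof.
move=> /pcard_leP/unsquash f.
have /choice[e eP] : forall i : 'I_m, exists e : Y * Y, adj e.1 e.2 /\
    f (val i) = orbit_of (@act_edge G Y) [set e.1; e.2].
  move=> i; have [_ [u [v [uv ->]]] <-] : edge_orbits Y (f (val i)).
    by apply: funS; exact: ltn_ord.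
  by exists (u, v).
exists e; split=> [i|i j]; first by case: (eP i).
have [ai fi] := eP i; have [aj fj] := eP j.
move/(edge_orbitP _ aj); rewrite -fi -fj => ff; apply/val_inj.
by apply: (@inj _ _ _ f) => //; rewrite inE; exact: ltn_ord.
Qed.

Lemma edge_representatives m : `I_m #= edge_orbits Y ->
  exists e : 'I_m -> Y * Y, [/\ forall i, adj (e i).1 (e i).2,
    forall i j, edge_equiv (e i) (e j) -> i = j &
    forall u v, adj u v -> exists i, edge_equiv (e i) (u, v)].
Proof.
move=> /card_set_bijP[f [f_fun f_inj f_surj]].
have /choice[e eP] : forall i : 'I_m, exists e : Y * Y, adj e.1 e.2 /\
    f (val i) = orbit_of (@act_edge G Y) [set e.1; e.2].
  move=> i; have [_ [u [v [uv ->]]] <-] : edge_orbits Y (f (val i)).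
    by apply: f_fun; exact: ltn_ord.
  by exists (u, v).
exists e; split=> [i|i j|u v uv]; first by case: (eP i).
  have [ai fi] := eP i; have [aj fj] := eP j.
  move/(edge_orbitP _ aj); rewrite -fi -fj => ff; apply/val_inj.
  by apply: f_inj => //; rewrite inE; exact: ltn_ord.
have [k km fk] : (f @` `I_m) (orbit_of (@act_edge G Y) [set u; v]).
  by apply: f_surj; exists [set u; v] => //; exists u, v.
exists (Ordinal km); apply/(edge_orbitP _ (e := (u, v))) => //.
by rewrite -(eP (Ordinal km)).2.
Qed.

Lemma vertex_representatives n : `I_n #= vertex_orbits Y ->
  exists x : 'I_n -> Y, (forall i j g, act g (x i) = x j -> i = j) /\
    forall y, exists i g, act g (x i) = y.
Proof.
move=> /card_set_bijP[f [f_fun f_inj f_surj]].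
have /choice[x xP] : forall i : 'I_n, exists x : Y, f (val i) = orbit_of (@act G Y) x.
  move=> i; have [x _ <-] : vertex_orbits Y (f (val i)).
    by apply: f_fun; exact: ltn_ord.
  by exists x.
exists x; split=> [i j g ij|y].
  have := (vertex_orbitP (x i) (x j)).2; rewrite -!xP => /(_ (ex_intro _ g ij)) ff.
  by apply/val_inj; apply: f_inj => //; rewrite inE; exact: ltn_ord.
have [k kn fk] : (f @` `I_n) (orbit_of (@act G Y) y) by apply: f_surj; exists y.
by exists (Ordinal kn); apply/vertex_orbitP; rewrite -xP.
Qed.

End Representatives.

Definition covers (G : groupType) (Y : gtree G) (s : seq Y) : Prop :=
  forall y, exists2 x, x \in s & exists g, act g x = y.

Section Comparison.
Variables (G : groupType) (X : gtree G).
Hypothesis noline : ~ invariant_line X.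
Hypothesis gbsX : commensurable_tree X.

Lemma card_bool_fun n : #|{ffun 'I_n -> bool}| = 2 ^ n.
Proof. by rewrite card_ffun card_bool card_ord. Qed.

(** Composing the injections of the previous part, with the vertices and edges of
    X on one side and those of Y on the other, yields 2^n <= 2^(size s). *)
Lemma covers_size_ge n (x : 'I_n -> X) (Y : gtree G) (s : seq Y) :
  commensurable_tree Y -> finite_set (edge_orbits X) ->
  (forall i j g, act g (x i) = x j -> i = j) ->
  edge_orbits X #<= edge_orbits Y -> covers s -> n <= size s.
Proof.
move=> gbsY /finite_setP[m]; rewrite card_eq_sym => Xm x_indep XY s_cover.
pose E : set G := [set g | exists y : X, stab y g].
have [e [e_adj _ e_cover]] := edge_representatives Xm.
have [|F F_inj] := @vertices_to_edges G E X m n e x e_adj _ e_cover x_indep.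
  by move=> g y yg; exists y.
have [|e' [e'_adj e'_indep]] := @independent_edges G Y m.
  by apply: card_le_trans XY; move: Xm; rewrite card_eq_le => /andP[].
have [||F' F'_inj] := @edges_to_vertices G E Y m (size s) e' (tnth (in_tuple s)) e'_adj _ e'_indep.
- by move=> g [y yg]; exact: gbs_elliptic_transfer noline gbsX gbsY yg.
- move=> y; have [z zs [g gz]] := s_cover y.
  have zi : index z s < size s by rewrite index_mem.
  by exists (Ordinal zi), g; rewrite (tnth_nth z) /= nth_index.
have := @cancel_factor (elliptic_hom E) _ _ _ (fun h => F (h, [ffun=> false])) (F' \o F)
  (elliptic_hom0 E).
rewrite !card_bool_fun leq_exp2l //; apply; last exact: inj_comp.
by move=> h h' /F_inj [].
Qed.

(** Vertices y i of Y whose stabilizers contain those of representatives x i of the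
    vertex orbits of X lie in different orbits, because X is fully reduced. The
    injections of the previous part then compare the numbers of edge orbits. *)
Lemma fully_reduced_edges_le (Y : gtree G) : cocompact X -> commensurable_tree Y ->
  fully_reduced X -> edge_orbits X #<= edge_orbits Y.
Proof.
move=> [/finite_setP[n Xn] /finite_setP[m Xm]] gbsY red.
have [/finite_setP[k Yk]|/infiniteP Yinf] := pselect (finite_set (edge_orbits Y)); last first.
  apply: card_le_trans Yinf; rewrite (card_le_eql Xm); exact: card_leT.
rewrite (card_le_eql Xm) (card_le_eqr Yk) card_le_II.
rewrite card_eq_sym in Xn; rewrite card_eq_sym in Xm; rewrite card_eq_sym in Yk.
pose E : set G := [set g | exists y : X, stab y g].
have [x [x_indep x_cover]] := vertex_representatives Xn.
have [e [e_adj e_indep _]] := edge_representatives Xm.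
have [e' [e'_adj _ e'_cover]] := edge_representatives Yk.
have XtoY (a : X) : exists b : Y, stab a `<=` stab b.
  have [g gP] := gbsX.1 a.
  have [b bg] := gbs_elliptic_transfer noline gbsX gbsY (free_generator_mem gP).
  by exists b => h /gP.2[j ->]; exact: stab_zpow.
have YtoX (b : Y) : exists a : X, stab b `<=` stab a.
  have [g gP] := gbsY.1 b.
  have [a ag] := gbs_stab_elliptic noline gbsY (free_generator_mem gP).
  by exists a => h /gP.2[j ->]; exact: stab_zpow.
have /choice[y yP] : forall i, exists b : Y, stab (x i) `<=` stab b by move=> i.
have [] := @edges_to_vertices G E X m n e x e_adj.
- by move=> g.
- exact: e_indep.
- exact: x_cover.
move=> F F_inj; have [] := @vertices_to_edges G E Y k n e' y e'_adj.
- by move=> g b bg; exact: gbs_stab_elliptic noline gbsY bg.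
- exact: e'_cover.
- move=> i j g gij; have [a aP] := YtoX (y j).
  have /vertex_orbitP[h1 E1] : orbit_of (@act G X) (x j) = orbit_of (@act G X) a.
    by apply: red => h /yP/aP.
  have /vertex_orbitP[h2 E2] : orbit_of (@act G X) (act g (x i)) = orbit_of (@act G X) a.
    apply: red => h hi; apply: aP; rewrite -gij.
    move: hi; rewrite -!/(stab _) !stab_act; exact: yP.
  apply: (x_indep i j (h1^-1 * (h2 * g))%g).
  by rewrite !actM E2 -E1 actK.
move=> F' F'_inj.
have := leq_card (F' \o F) (inj_comp F'_inj F_inj).
by rewrite !card_prod !card_bool_fun leq_pmul2r ?card_bool // leq_exp2l.
Qed.

End Comparison.

(** * Two moves that lower or keep the number of vertex orbits *)

(** Stated as the existence of a transitive G-set with point stabilizer C, so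
    that cosets do not have to be mentioned again. *)
Lemma coset_space (G : groupType) (C : set G) : subgroup C ->
  exists (W : choiceType) (aW : G -> W -> W) (w0 : W),
    [/\ forall w, aW 1%g w = w, forall g h w, aW (g * h)%g w = aW g (aW h w),
        forall w, exists g, w = aW g w0 & forall g, aW g w0 = w0 <-> C g].
Proof.
move=> [C1 CM CV]; pose co (g : G) : set G := [set h | C (g^-1 * h)%g].
pose tr (g : G) (A : set G) : set G := [set h | A (g^-1 * h)%g].
have trco g h : tr g (co h) = co (g * h)%g.
  by apply/seteqP; split=> k; rewrite /tr /co /= invgM mulgA.
pose W := {A : set G | `[< exists g, A = co g >]}.
have mem g : `[< exists h, co g = co h >] by apply/asboolP; exists g.
have trW g (w : W) : `[< exists h, tr g (sval w) = co h >].
  by case: w => A /= /asboolP[h ->]; rewrite trco; apply/asboolP; exists (g * h)%g.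
exists W, (fun g w => exist _ (tr g (sval w)) (trW g w)), (exist _ (co 1%g) (mem 1%g)).
split=> [w|g h w|[A AP]|g].
- by apply/val_inj/seteqP; split=> k; rewrite /= /tr /= invg1 mul1g.
- by apply/val_inj/seteqP; split=> k; rewrite /= /tr /= invgM mulgA.
- have /asboolP[g Ag] := AP; exists g; apply/val_inj.
  by rewrite /= trco mulg1.
split=> [/(congr1 val) /=|Cg].
  rewrite trco mulg1 => E; have : co g g by rewrite /co /= mulVg.
  by rewrite E /co /= invg1 mul1g.
apply/val_inj; rewrite /= trco mulg1; apply/seteqP; split=> h; rewrite /co /=.
  by move=> Ch; rewrite invg1 mul1g -(mulVKg g h); exact: CM.
by rewrite invg1 mul1g => Ch; exact: (CM _ _ (CV _ Cg) Ch).
Qed.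

Lemma commensurable_tree_sub (G : groupType) (X Y : gtree G) :
  commensurable_tree X -> (forall p : Y, exists a, free_generator (stab p) a) ->
  (forall p : Y, exists v : X, stab p `<=` stab v) -> commensurable_tree Y.
Proof.
move=> [gX cX] gY sub; split=> // p q.
have [v pv] := sub p; have [u qu] := sub q; have [k k1 [kv ku]] := cX v u.
have [a ga] := gY p; have [b gb] := gY q; have [c gc] := gX v; have [d genu] := gX u.
have [i [j [i0 j0 E1]]] := free_generator_meet gc (pv _ (free_generator_mem ga)) kv (free_generator_neq1 ga) k1.
have [i' [j' [i0' j0' E2]]] := free_generator_meet genu (qu _ (free_generator_mem gb)) ku (free_generator_neq1 gb) k1.
exists (zpow k (j * j')%R).
  by apply: free_generator_torsion_free gc kv k1 _; rewrite mulf_neq0.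
split.
  by rewrite zpowM -E1 -zpowM; apply: stab_zpow; exact: free_generator_mem.
by rewrite mulrC zpowM -E2 -zpowM; apply: stab_zpow; exact: free_generator_mem.
Qed.

Section CollapseEdge.
Variables (G : groupType) (X : gtree G) (x z : X).
Hypothesis xz : adj x z.
Hypothesis z_out : forall g, act g x <> z.
Hypothesis x_sub : stab x `<=` stab z.

(** The orbit of x is retracted to that of z by sending g x to g z, which is well
    defined since the stabilizer of x fixes z. *)
Lemma collapse_ascending_edge (s : seq X) : commensurable_tree X -> covers s ->
  exists (Y : gtree G) (s' : seq Y), [/\ commensurable_tree Y, covers s' & size s' < size s].
Proof.
move=> gbsX s_cover.
have /choice[r rP] : forall y, exists y', (forall g, y = act g x -> y' = act g z) /\
    ((forall g, y <> act g x) -> y' = y).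
  move=> y; have [[g ->]|N] := pselect (exists g, y = act g x).
    exists (act g z); split=> [h gh|/(_ g)//].
    have : stab x (h^-1 * g)%g by rewrite /stab /stabilizer /= actM gh actK.
    move=> /x_sub; rewrite /stab /stabilizer /= actM => E.
    by rewrite -[in RHS]E actVK.
  by exists y; split=> // g yg; case: N; exists g.
have r_in g : r (act g x) = act g z by apply: (rP _).1.
have r_out y : (forall g, y <> act g x) -> r y = y by apply: (rP _).2.
have in_or y : (exists g, y = act g x) \/ (forall g, y <> act g x).
  have [|N] := pselect (exists g, y = act g x); [by left|right=> g yg].
  by apply: N; exists g.
have out_z g h : act g z <> act h x.
  by move=> E; apply: (z_out (g := (g^-1 * h)%g)); rewrite actM -E actK.
have r_idem v : r (r v) = r v.
  case: (in_or v) => [[g ->]|N]; last by rewrite !(r_out v N).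
  by rewrite r_in r_out // => h; exact: out_z.
have r_adj v : r v = v \/ adj v (r v).
  case: (in_or v) => [[g ->]|N]; last by left; exact: r_out.
  by right; rewrite r_in act_adj.
have r_act g v : r (act g v) = act g (r v).
  case: (in_or v) => [[h ->]|N]; first by rewrite -actM !r_in actM.
  rewrite (r_out v N) r_out // => h E; apply: (N (g^-1 * h)%g).
  by rewrite actM -E actK.
pose Y := collapse r_idem r_adj r_act.
exists Y, (map (retract r_idem) [seq v <- s | r v == v]); split.
- apply: (commensurable_tree_sub gbsX) => p.
    have [a ga] := gbsX.1 (val p); exists a.
    by rewrite collapse_stab.
  by exists (val p); rewrite collapse_stab.
- move=> p; have [v vs [g gv]] := s_cover (val p).
  have rp : r (val p) = val p by apply/eqP; exact: (svalP p).
  have rv : r v = v by apply: (@act_inj G X g); rewrite -r_act gv.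
  exists (retract r_idem v); first by apply: map_f; rewrite mem_filter rv eqxx.
  by exists g; apply/val_inj; rewrite /= rv gv.
- rewrite size_map size_filter ltn_neqAle count_size andbT -all_count.
  apply/negP => /allP all_s; have [v vs [g gv]] := s_cover x.
  have /eqP := all_s _ vs => rv.
  have : r x = x by rewrite -gv r_act rv.
  have := r_in 1%g; rewrite !act1 => -> zx; apply: (z_out (g := 1%g)).
  by rewrite act1 zx.
Qed.

End CollapseEdge.

Section Induction.
Variables (G : groupType) (X : gtree G) (x z : X) (t : G) (C : set G).
Hypothesis xt : adj x (act t x).
Hypothesis xz : adj x z.
Hypothesis xz_xt : ~ edge_equiv (x, z) (x, act t x).
Hypothesis C_subgroup : subgroup C.
Hypothesis tx_C : stab (act t x) `<=` C.
Hypothesis xz_C : stab x `&` stab z `<=` C.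
Hypothesis C_x : C `<=` stab x.

(** The induction move at the edge (x, t x), for a subgroup C of the stabilizer of
    x that contains the stabilizers of t x and of the edge xz. First x is
    expanded: a new vertex w with stabilizer C is joined to x, and the edges from
    x to z and to t x are attached to w. Then t x, whose stabilizer lies in C, is
    collapsed into w, and with it the whole orbit of x. The edge from x to w
    becomes an edge from t^-1 w to w. The outcome has w in place of x, and if
    z = g x then z is replaced by g t^-1 w. *)
Lemma induction_move : commensurable_tree X ->
  exists (Y : gtree G) (x' z' : Y),
  [/\ [/\ commensurable_tree Y, stab x' = C, adj x' (act t x') & adj x' z'],
      stab x' `&` stab z' = stab x `&` stab z,
      ((forall g, act g x <> z) -> forall g, act g x' <> z') /\
      forall g, act g x = z -> act (g * t^-1)%g x' = z',
      forall y, (forall g, act g x <> y) ->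
        exists2 y' : Y, stab y' = stab y & forall g, act g x' <> y' &
      forall s : seq X, covers s -> exists2 s' : seq Y, covers s' & size s' = size s].
Proof.
move=> gbsX; have [C1 CM CV] := C_subgroup.
have [W [aW [w0 [aW1 aWM aWt aWs]]]] := coset_space C_subgroup.
have aW_eq g h : aW g w0 = aW h w0 <-> C (h^-1 * g)%g.
  rewrite -aWs aWM; split=> [->|E]; first by rewrite -aWM mulVg aW1.
  by rewrite -{2}E -aWM mulgV aW1.
have fix_x g h : C (h^-1 * g)%g -> act g x = act h x.
  by move/C_x => E; rewrite -[in RHS]E -actM mulVKg.
have /choice[f fP] : forall w, exists y, forall g, w = aW g w0 -> y = act g x.
  move=> w; have [h ->] := aWt w; exists (act h x) => g /aW_eq/fix_x //.
have fE g : f (aW g w0) = act g x by exact: fP.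
have f_act g w : f (aW g w) = act g (f w).
  by have [h ->] := aWt w; rewrite -aWM !fE actM.
pose R y q w := exists g, [/\ w = aW g w0, y = act g x &
   q = act g z \/ q = act g (act t x)].
have fixP (g h : G) (v : X) : act g v = act h v -> stab v (h^-1 * g)%g.
  by move=> E; rewrite /stab /stabilizer /= actM E actK.
(* The edges xz and (x, t x) lie in different orbits, so an edge at x is attached
   to at most one leaf. *)
have R_cross g h : act g x = act h x -> act g z <> act h (act t x).
  move=> gx gz; apply: xz_xt; exists (h^-1 * g)%g.
  by rewrite /same_edge /= !actM gx gz !actK !eqxx.
have R_unique y q w w' : R y q w -> R y q w' -> w = w'.
  move=> [g [-> -> qg]] [h [-> yh qh]]; apply/aW_eq.
  case: qg qh => -> [] E.
  - by apply: xz_C; split; exact: fixP.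
  - by case: (R_cross g h).
  - by case: (R_cross h g).
  - by apply: tx_C; exact: fixP.
have /choice[att' attP'] : forall yq : X * X, exists o, forall w,
    o = Some w <-> R yq.1 yq.2 w.
  move=> [y q] /=; have [[w Rw]|N] := pselect (exists w, R y q w).
    by exists (Some w) => w'; split=> [[<-]//|/(R_unique _ _ _ _ Rw) ->].
  by exists None => w; split=> // Rw; case: N; exists w.
pose att y q := att' (y, q).
have attP y q w : att y q = Some w <-> R y q w by exact: attP'.
have att_f y q w : att y q = Some w -> f w = y.
  by move=> /attP[g [-> -> _]]; rewrite fE.
have R_act g y q w : R y q w -> R (act g y) (act g q) (aW g w).
  move=> [h [-> -> qh]]; exists (g * h)%g; split; rewrite ?aWM ?actM //.
  by case: qh => ->; [left|right].
have att_act g y q : att (act g y) (act g q) = omap (aW g) (att y q).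
  case E : (att y q) => [w|] /=; first by apply/attP/R_act/attP.
  case E' : (att _ _) => [w|] //; move: E' => /attP/(R_act g^-1%g).
  by rewrite !actK => /attP; rewrite E.
pose X1 := expand aW1 aWM f_act att_f att_act.
have att_xz : attach att x z = inr w0.
  rewrite /attach; have -> : att x z = Some w0; last by [].
  by apply/attP; exists 1%g; rewrite aW1 !act1; split=> //; left.
have att_xt : attach att x (act t x) = inr w0.
  rewrite /attach; have -> : att x (act t x) = Some w0; last by [].
  by apply/attP; exists 1%g; rewrite aW1 !act1; split=> //; right.
have att_zx : attach att z x = inl z.
  rewrite /attach; case E : (att z x) => [w|] //.
  move: E => /attP[g [_ zg [xg|xg]]]; first by case: (act_noinv xz (conj (esym zg) (esym xg))).
  have E1 : act g^-1%g x = act t x by rewrite {1}xg actK.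
  have E2 : act g^-1%g z = x by rewrite zg actK.
  by case: xz_xt; exists g^-1%g; rewrite /same_edge /= E1 E2 !eqxx orbT.
have att_tx : attach att (act t x) x = inl (act t x).
  rewrite /attach; case E : (att (act t x) x) => [w|] //.
  move: E => /attP[g [_ tg [xg|xg]]]; last by case: (act_noinv xt (conj (esym tg) (esym xg))).
  by case: xz_xt; exists g; rewrite /same_edge /= -tg -xg !eqxx orbT.
have adj_wz : @adj G X1 (inr w0) (inl z).
  by rewrite -att_xz -att_zx; exact: expand_adj_old.
have adj_wt : @adj G X1 (inr w0) (inl (act t x)).
  by rewrite -att_xt -att_tx; exact: expand_adj_old.
have adj_wx : @adj G X1 (inr w0) (inl x).
  by have := expand_adj_new f att w0; rewrite -[w0 in f w0]aW1 fE act1.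
have /choice[rl rlP] : forall y : X, exists p : X + W,
    (forall g, y = act g x -> p = inr (aW (g * t^-1)%g w0)) /\
    ((forall g, y <> act g x) -> p = inl y).
  move=> y; have [[g ->]|N] := pselect (exists g, y = act g x).
    exists (inr (aW (g * t^-1)%g w0)); split=> [h gh|/(_ g)//].
    congr inr; apply/aW_eq; rewrite invgM invgK; apply: tx_C.
    have := stab_conj t (fixP _ _ _ gh).
    by rewrite !mulgA.
  by exists (inl y); split=> // g yg; case: N; exists g.
have rl_in g : rl (act g x) = inr (aW (g * t^-1)%g w0) by apply: (rlP _).1.
have rl_out y : (forall g, y <> act g x) -> rl y = inl y by apply: (rlP _).2.
have in_or y : (exists g, y = act g x) \/ (forall g, y <> act g x).
  have [|N] := pselect (exists g, y = act g x); [by left|right=> g yg].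
  by apply: N; exists g.
pose r (p : X1) : X1 := match p with inl y => rl y | inr w => inr w end.
have r_idem p : r (r p) = r p.
  case: p => [y|w] //=; case: (in_or y) => [[g ->]|N]; first by rewrite rl_in.
  by rewrite (rl_out _ N) /= (rl_out _ N).
have r_adj p : r p = p \/ adj p (r p).
  case: p => [y|w]; last by left.
  case: (in_or y) => [[g ->]|N]; last by left; exact: rl_out.
  right; have -> : r (inl (act g x)) = act (g * t^-1)%g (inr w0 : X1) by rewrite /= rl_in.
  have -> : inl (act g x) = act (g * t^-1)%g (inl (act t x) : X1).
    by rewrite /= -actM mulgVK.
  by rewrite act_adj adj_sym.
have r_act g p : r (act g p) = act g (r p).
  case: p => [y|w] //=; case: (in_or y) => [[h ->]|N].
    by rewrite -actM !rl_in /= -aWM mulgA.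
  rewrite (rl_out y N) rl_out // => h E; apply: (N (g^-1 * h)%g).
  by rewrite actM -E actK.
pose Y := collapse r_idem r_adj r_act.
have stabY (p : X1) : stab (retract r_idem p : Y) = stab (r p) by rewrite collapse_stab.
pose x' : Y := retract r_idem (inr w0 : X1).
pose z' : Y := retract r_idem (inl z : X1).
have stab_x' : stab x' = C.
  by rewrite /x' stabY /= expand_stab_new; apply/seteqP; split=> g /=; rewrite aWs.
have r_z : r (inl z) <> inr w0.
  move=> /=; case: (in_or z) => [[g zg]|N]; last by rewrite rl_out.
  rewrite zg rl_in => -[/aWs/C_x E]; apply: xz_xt; exists (g * t^-1)%g^-1%g.
  have E1 : act (g * t^-1)%g^-1%g x = x by rewrite -{1}E actK.
  have E2 : act (g * t^-1)%g^-1%g z = act t x.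
    by rewrite zg -actM invgM invgK mulgVK.
  by rewrite /same_edge /= E1 E2 !eqxx.
have x'z' : adj x' z'.
  by apply: collapse_edge => //; apply/eqP => E; apply: r_z; rewrite -E.
have r_x : r (inl x) = inr (aW t^-1%g w0).
  by rewrite /= -[in rl x](act1 x) rl_in mul1g.
have ret_act g p : act g (retract r_idem p : Y) = retract r_idem (act g p).
  by rewrite retract_act.
have x'_act g : act g x' = retract r_idem (inr (aW g w0) : X1) by rewrite /x' ret_act.
have x'tx' : adj x' (act t x').
  have : adj (act t (retract r_idem (inr w0 : X1) : Y)) (act t (retract r_idem (inl x : X1) : Y)).
    rewrite act_adj; apply: collapse_edge => //; rewrite r_x /=.
    apply/eqP => -[/esym/aWs/C_x E].
    by move: xt; rewrite -{2}E actVK adj_irr.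
  rewrite adj_sym (_ : act t (retract r_idem (inl x : X1) : Y) = x') //.
  rewrite ret_act; apply/val_inj; change (r (act t (inl x : X1)) = inr w0).
  by rewrite r_act r_x /= -aWM mulgV aW1.
exists Y, x', z'; split.
- split=> //; apply: (commensurable_tree_sub gbsX) => p.
    have -> : stab p = stab (val p) by rewrite collapse_stab.
    case: (val p) => [y|w]; first by rewrite expand_stab_old; exact: gbsX.1.
    have [g ->] := aWt w.
    have -> : stab (inr (aW g w0) : X1) = conj_set g C.
      rewrite -[inr (aW g w0)]/(act g (inr w0 : X1)) stab_act expand_stab_new.
      by congr conj_set; apply/seteqP; split=> h /=; rewrite aWs.
    have [a ga] := gbsX.1 x.
    have [k k1 [kx kz]] := gbsX.2 x z.
    have [d iC] : exists d, has_index (stab x) C d.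
      by apply: (has_index_exists ga) => //; exists k => //; exact: xz_C.
    by eexists; exact: free_generator_conj (has_index_gen iC ga).
  have -> : stab p = stab (val p) by rewrite collapse_stab.
  case: (val p) => [y|w]; first by exists y; rewrite expand_stab_old.
  have [g ->] := aWt w; exists (act g x).
  rewrite -[inr (aW g w0)]/(act g (inr w0 : X1)) !stab_act expand_stab_new => h /=.
  by rewrite /conj_set /= aWs => /C_x.
- apply/seteqP; split=> g [gx gz].
    have := @collapse_edge_stab _ _ r r_idem r_adj r_act (inr w0) (inl z) adj_wz.
    move=> /(_ _ g (conj gx gz))[|_]; first by apply/eqP => E; apply: r_z; rewrite -E.
    rewrite expand_stab_old; split=> //; apply: C_x; by rewrite -stab_x'.
  have Cg : C g by exact: xz_C.
  split; first by rewrite stab_x'.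
  by change (act g z' = z'); rewrite ret_act /= gz.
- split=> [z_out g|g gz].
    move/(congr1 val); rewrite x'_act /= rl_out // => h E.
    by apply: (z_out h).
  by rewrite x'_act; apply/val_inj; rewrite /= -gz rl_in.
- move=> y y_out; exists (retract r_idem (inl y : X1)).
    rewrite stabY /= rl_out ?expand_stab_old // => g E.
    by apply: (y_out g).
  move=> g /(congr1 val); rewrite x'_act /= rl_out // => h E.
  by apply: (y_out h).
- move=> s s_cover; exists (map (fun v => retract r_idem (inl v : X1)) s); last by rewrite size_map.
  have hit y : exists2 p, p \in map (fun v => retract r_idem (inl v : X1)) s &
      exists g, act g (p : Y) = retract r_idem (inl y : X1).
    have [v vs [g <-]] := s_cover y; exists (retract r_idem (inl v : X1)).
      exact: map_f.
    by exists g; rewrite ret_act.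
  move=> p; have [q qs [g gq]] : exists2 q, q \in map (fun v => retract r_idem (inl v : X1)) s &
      exists g, act g (q : Y) = retract r_idem (val p).
    case: (val p) => [y|w]; first exact: hit.
    have [h ->] := aWt w; have [q qs [g gq]] := hit (act (h * t)%g x).
    exists q => //; exists g; rewrite gq; apply/val_inj.
    by rewrite /= rl_in mulgK.
  by exists q => //; exists g; rewrite gq retractE.
Qed.

End Induction.

(** * Ascending edges *)

Section Ascending.
Variable G : groupType.

(** In the quotient graph of groups this is a loop with index 1 at one end
    and N at the other, an ascending HNN extension. *)
Definition ascending (X : gtree G) (x : X) (t : G) (N : nat) : Prop :=
  adj x (act t x) /\ has_index (stab x) (stab (act t x)) N.

Definition dominated (X : gtree G) (x : X) : Prop :=
  exists2 y : X, (forall g, act g x <> y) & stab x `<=` stab y.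

Definition coverable (X : gtree G) (n : nat) : Prop :=
  exists2 s : seq X, covers s & size s <= n.

(** The edges xz that help: those that leave the orbit of x, and those whose index
    at z contributes a prime that does not divide N. *)
Definition exit_or_new_prime (X : gtree G) (x z : X) (N : nat) : Prop :=
  (forall g, act g x <> z) \/
  exists s M p, [/\ act s x = z, has_index (stab z) (stab x `&` stab z) M,
    prime p, p %| M & ~~ (p %| N)].

Definition smooth (d N : nat) : Prop := forall p, prime p -> p %| d -> p %| N.

Lemma ascending_act (X : gtree G) (x : X) t N g : ascending x t N ->
  ascending (act g x) (g * t * g^-1)%g N.
Proof.
rewrite /ascending -actM mulgVK actM act_adj => -[xt iN]; split=> //.
by rewrite !(stab_act _ g); exact: has_index_conj.
Qed.

Lemma dominated_act (X : gtree G) (x : X) g : dominated x -> dominated (act g x).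
Proof.
move=> [y xy sub]; exists (act g y).
  by move=> h E; apply: (xy (g^-1 * (h * g))%g); rewrite !actM E actK.
by move=> h; rewrite !stab_act; exact: sub.
Qed.

Lemma edge_index (X : gtree G) (u v : X) : commensurable_tree X ->
  exists d, has_index (stab u) (stab u `&` stab v) d.
Proof.
move=> [gX cX]; have [a ga] := gX u; have [k k1 [ku kv]] := cX u v.
apply: (has_index_exists ga).
- by apply: subgroup_meet; exact: stab_subgroup.
- by move=> g [].
- by exists k.
Qed.

(** A translate of the edge (x, t x) joins two vertices of the orbit of x, and its
    indices are 1 and N, so that it brings no new prime. *)
Lemma exit_or_new_prime_not_equiv (X : gtree G) (x z : X) t N : ascending x t N ->
  exit_or_new_prime x z N -> ~ edge_equiv (x, z) (x, act t x).
Proof.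
move=> [_ iN] [z_out|[s [M [p [sx iM pp pM pN]]]]] [g /=].
  move=> /orP[] /andP[/eqP xg /eqP tg].
    by apply: (z_out (g^-1 * t)%g); rewrite actM tg actK.
  by apply: (z_out g^-1%g); rewrite {1}xg actK.
have iMg := has_index_conj g iM; rewrite -stab2_act -stab_act in iMg.
have [_ [txx [a ga _]]] := iN; have ga' := has_index_gen iN ga.
have meet : stab x `&` stab (act t x) = stab (act t x).
  by apply/seteqP; split=> [h []//|h th]; split=> //; exact: txx.
move=> /orP[] /andP[/eqP xg /eqP tg]; rewrite -tg -xg in iMg.
  rewrite meet in iMg; have M1 := has_index_unique iMg (has_index_refl ga').
  by move: pM; rewrite M1 dvdn1 => /eqP p1; rewrite p1 in pp.
rewrite setIC meet in iMg; have MN := has_index_unique iMg iN.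
by move: pN; rewrite -MN pM.
Qed.

(** The induction move for the subgroup C that is the join of the stabilizers of
    t x and of the edge xz; its index in the stabilizer of x is gcd(d, N). The
    indices of the edges after the move come from chains of subgroups. *)
Lemma induction_step (X : gtree G) (x z : X) t N d : commensurable_tree X ->
  ascending x t N -> adj x z -> ~ edge_equiv (x, z) (x, act t x) ->
  has_index (stab x) (stab x `&` stab z) d ->
  exists (Y : gtree G) (x' z' : Y),
  [/\ commensurable_tree Y, forall n, coverable X n -> coverable Y n,
      dominated x -> dominated x', ascending x' t N &
  [/\ adj x' z', has_index (stab x') (stab x' `&` stab z') (d %/ gcdn d N),
      (forall g, act g x <> z) -> (forall g, act g x' <> z') &
      forall s M, act s x = z -> has_index (stab z) (stab x `&` stab z) M ->
        act (s * t^-1)%g x' = z' /\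
        has_index (stab z') (stab x' `&` stab z') (N %/ gcdn d N * M)]].
Proof.
move=> gbsX [xt iN] xz ne id.
have [C [iC xzC txC]] := has_index_join id iN.
have [c0 [Cx [a ga _]]] := iC.
have [] := @induction_move G X x z t C xt xz ne
  (free_generator_subgroup (has_index_gen iC ga)) txC xzC Cx gbsX.
move=> Y [x' [z' [[gbsY x'C x't x'z'] inter [out loop] dom cov]]].
have [f iCd dE] := has_index_dvd iC id xzC.
have [e iCt NE] := has_index_dvd iC iN txC.
have fE : d %/ gcdn d N = f by rewrite {1}dE mulKn.
have eE : N %/ gcdn d N = e by rewrite {1}NE mulKn.
exists Y, x', z'; split=> //.
- move=> n [s s_cov s_n]; have [s' s'_cov s's] := cov s s_cov.
  by exists s'; rewrite // s's.
- move=> [y xy sub]; have [y' y'E y'_out] := dom y xy.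
  by exists y' => //; rewrite y'E x'C => g /Cx/sub.
- split=> //; rewrite stab_act x'C.
  have iCt' := has_index_conj t iC; rewrite -stab_act in iCt'.
  have [|h iCC hE] := has_index_dvd iC (has_index_trans iN iCt').
    by move=> g /(has_index_sub iCt')/txC.
  suff -> : N = h by [].
  by apply/eqP; rewrite -(eqn_pmul2l c0) mulnC hE.
split=> //; first by rewrite inter x'C fE.
move=> s M sx iM; have z'E := loop s sx; split=> //.
rewrite inter -z'E stab_act x'C eE; apply: has_index_trans iM.
have := has_index_conj (s * t^-1)%g iCt; rewrite -stab_act.
by rewrite -actM mulgVK sx.
Qed.

(** Walk along the path to a vertex y outside the orbit of x whose stabilizer
    contains that of x. As long as the walk stays in the orbit and meets no edge
    that brings a new prime, the stabilizer of x has N-smooth index in the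
    stabilizers of the vertices met. *)
Lemma dominated_exit (X : gtree G) (x : X) N : commensurable_tree X -> dominated x ->
  exists g z d, [/\ adj (act g x) z, has_index (stab (act g x)) (stab (act g x) `&` stab z) d,
    smooth d N & exit_or_new_prime (act g x) z N].
Proof.
move=> gbsX [y y_out xy].
have walk p g e : path (@adj G X) (act g x) p -> has_index (stab (act g x)) (stab x) e ->
    smooth e N -> (forall w, w \in p -> stab x `<=` stab w) ->
    (forall h, act h x <> last (act g x) p) ->
    exists g z d, [/\ adj (act g x) z,
      has_index (stab (act g x)) (stab (act g x) `&` stab z) d,
      smooth d N & exit_or_new_prime (act g x) z N].
  elim: p g e => [|w p IH] g e /=; first by move=> _ _ _ _ /(_ g).
  move=> /andP[gw pP] ie sm fixed out.
  have xw : stab x `<=` stab w by apply: fixed; rewrite inE eqxx.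
  have [d id] := edge_index (act g x) w gbsX.
  have [|f iF eE] := has_index_dvd id ie.
    by move=> h hx; split; [exact: has_index_sub ie hx|exact: xw].
  have dsm : smooth d N by move=> q qp qd; apply: sm => //; rewrite eE dvdn_mulr.
  have [[h hw]|w_out] := pselect (exists h, act h x = w); last first.
    exists g, w, d; split=> //; left=> h E; apply: w_out; exists (h * g)%g.
    by rewrite actM.
  have [M] := edge_index w (act g x) gbsX; rewrite setIC => iM.
  have [Msm|Mbad] := pselect (smooth M N); last first.
    exists g, w, d; split=> //; right; exists (h * g^-1)%g, M.
    have [p0 p0P] : exists q, [/\ prime q, q %| M & ~~ (q %| N)].
      apply: contrapT => no; apply: Mbad => q qp qM; apply: contrapT => /negP qN.
      by apply: no; exists q.
    by exists p0; case: p0P => *; split=> //; rewrite actM actK.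
  rewrite -hw in pP out iM iF *.
  apply: (IH h (M * f)) => //.
  - exact: has_index_trans iM iF.
  - move=> q qp; rewrite Euclid_dvdM // => /orP[/(Msm q qp)//|qf].
    by apply: sm => //; rewrite eE dvdn_mull.
  - by move=> u up; apply: fixed; rewrite inE up orbT.
have [a ga] := gbsX.1 x.
apply: (walk (tree_geod x y) 1%g 1); rewrite ?act1.
- exact: geod_path.
- exact: has_index_refl ga.
- by move=> q qp; rewrite dvdn1 => /eqP q1; rewrite q1 in qp.
- by move=> w wp h hx; apply: tree_geod_fixed wp => //; exact: xy.
- by move=> h; rewrite geod_last.
Qed.

Variable n : nat.
Hypothesis n_min : forall (Y : gtree G) (s : seq Y),
  commensurable_tree Y -> covers s -> n <= size s.

(** Otherwise the edge xz could be collapsed, which would lower the number of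
    vertex orbits. *)
Lemma no_ascending_exit (X : gtree G) (x z : X) : commensurable_tree X -> coverable X n ->
  adj x z -> (forall g, act g x <> z) -> ~ stab x `<=` stab z.
Proof.
move=> gbsX [s s_cov s_n] xz out sub.
have [Y [s' [gbsY s'_cov s's]]] := collapse_ascending_edge xz out sub gbsX s_cov.
by have := n_min gbsY s'_cov; rewrite leqNgt (leq_trans s's).
Qed.

(** Induction steps make d smaller until it is 1, since an N-smooth d > 1 is not
    coprime to N. The edge xz then cannot leave the orbit of x by
    [no_ascending_exit], hence it is ascending in the direction from z to x. A
    last induction step multiplies its index M by N. *)
Lemma ascending_grows (X : gtree G) (x z : X) t N d :
  commensurable_tree X -> coverable X n -> ascending x t N -> dominated x ->
  adj x z -> has_index (stab x) (stab x `&` stab z) d -> smooth d N ->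
  exit_or_new_prime x z N ->
  exists (X' : gtree G) (x' : X') t' N', [/\ commensurable_tree X', coverable X' n,
    ascending x' t' N', dominated x' & size (primes N) < size (primes N')].
Proof.
elim/ltn_ind: d X x z => d IH X x z gbsX cov asc dom xz id sm pr.
have ne := exit_or_new_prime_not_equiv asc pr.
have N0 : 0 < N by case: asc => _ [].
have [Y [x' [z' [gbsY covY domY ascY [x'z' id' out loop]]]]] :=
  induction_step gbsX asc xz ne id.
have d0 : 0 < d by case: id.
have [d1|d1] := leqP d 1; last first.
  have g1 : 1 < gcdn d N.
    have := pdiv_dvd d; have := pdiv_prime d1; move: (pdiv d) => q qp qd.
    by apply: leq_trans (prime_gt1 qp) (dvdn_leq _ _); rewrite ?gcdn_gt0 ?d0 // dvdn_gcd qd sm.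
  have dd : d %/ gcdn d N < d by rewrite ltn_Pdiv.
  apply: (IH _ dd Y x' z') => //; first exact: covY; first exact: domY.
    move=> q qp qd; apply: sm => //; apply: dvdn_trans qd _.
    by apply/dvdnP; exists (gcdn d N); rewrite mulnC divnK ?dvdn_gcdl.
  case: pr => [z_out|[s [M [p [sx iM pp pM pN]]]]]; first by left; exact: out.
  have [z'E iM'] := loop s M sx iM.
  right; exists (s * t^-1)%g, (N %/ gcdn d N * M), p; split=> //.
  exact: dvdn_mull.
have dE : d = 1 by apply/eqP; rewrite eqn_leq d1.
rewrite dE in id id' loop; rewrite gcd1n divn1 in id' loop.
case: pr => [z_out|[s [M [p [sx iM pp pM pN]]]]].
  by case: (no_ascending_exit gbsX cov xz z_out) => g /(has_index1 id)[].
have [z'E iM'] := loop s M sx iM; rewrite divn1 in iM'.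
exists Y, z', (s * t^-1)%g^-1%g, (N * M); split=> //.
- exact: covY.
- split; rewrite -{2}z'E actK; first by rewrite adj_sym.
  suff <- : stab x' `&` stab z' = stab x' by [].
  by apply/seteqP; split=> [g []//|g /(has_index1 id')].
- by rewrite -z'E; apply: dominated_act; exact: domY.
have M0 : 0 < M by case: iM.
have : {subset p :: primes N <= primes (N * M)}.
  move=> q; rewrite inE => /orP[/eqP->|].
    by rewrite mem_primes pp muln_gt0 N0 M0 dvdn_mull.
  by rewrite !mem_primes muln_gt0 N0 M0 => /and3P[-> _ qN]; rewrite dvdn_mulr.
move/(uniq_leq_size _); apply; rewrite /= primes_uniq andbT.
by rewrite mem_primes negb_and negb_and pN !orbT.
Qed.

End Ascending.

Section PrimeBound.
Variables (G : groupType) (X : gtree G).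
Hypothesis noline : ~ invariant_line X.
Hypothesis gbsX : commensurable_tree X.

(** Up to translation there are finitely many edges, each with two indices. *)
Lemma edge_index_primes : finite_set (edge_orbits X) ->
  exists L : seq nat, forall (u v : X) d p, adj u v ->
    has_index (stab u) (stab u `&` stab v) d -> prime p -> p %| d -> p \in L.
Proof.
move=> /finite_setP[m]; rewrite card_eq_sym => /edge_representatives[e [_ _ e_cover]].
have /choice[d1 d1P] : forall i, exists d,
    has_index (stab (e i).1) (stab (e i).1 `&` stab (e i).2) d.
  by move=> i; exact: edge_index.
have /choice[d2 d2P] : forall i, exists d,
    has_index (stab (e i).2) (stab (e i).2 `&` stab (e i).1) d.
  by move=> i; exact: edge_index.
exists (flatten [seq primes (d1 i) ++ primes (d2 i) | i <- enum 'I_m]) => u v d p uv id pp pd.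
have [i [g /=]] := e_cover u v uv; move=> gi; apply/flatten_mapP; exists i.
  by rewrite mem_enum.
have d0 : 0 < d by case: id.
rewrite mem_cat !mem_primes pp /=; case/orP: gi => /andP[/eqP ug /eqP vg]; rewrite ug vg in id.
  have := has_index_conj g (d1P i); rewrite -stab2_act -stab_act => id1.
  by rewrite -(has_index_unique id id1) d0 pd.
have := has_index_conj g (d2P i); rewrite -stab2_act -stab_act => id2.
by rewrite -(has_index_unique id id2) d0 pd orbT.
Qed.

Variable p : nat.
Hypothesis p_prime : prime p.
Hypothesis p_edges : forall (u v : X) d, adj u v ->
  has_index (stab u) (stab u `&` stab v) d -> ~~ (p %| d).

(** Move v along a path from u. The new index divides the product of the previous
    one with the index of an edge. *)
Lemma prime_vertex_index (u v : X) d :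
  has_index (stab u) (stab u `&` stab v) d -> ~~ (p %| d).
Proof.
have [q] := tree_connected u v; elim/last_ind: q v d => [|q w IH] v d /=.
  move=> _ <-; rewrite setIid => id; have [a ga] := gbsX.1 u.
  rewrite (has_index_unique id (has_index_refl ga)).
  by rewrite Euclid_dvd1.
rewrite rcons_path last_rcons => /andP[qP wq] <- {v} id.
have {}IH d' := IH (last u q) d' qP erefl.
move: (last u q) IH wq => v {}IH vw.
have [d1 id1] := edge_index u v gbsX; have pd1 := IH _ id1.
have [f iF] := edge_index v w gbsX; have pf := p_edges vw iF.
have [a] := edge_index v u gbsX; rewrite setIC => ia.
have iL := has_index_meet ia iF.
have [|g ig gE] := has_index_dvd ia iL; first by move=> h [].
have pg : ~~ (p %| g).
  apply: contra pf => pg; have a0 : 0 < a by case: ia.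
  have : f = g * gcdn a f.
    by apply/eqP; rewrite -(eqn_pmul2l a0) mulnA -gE muln_lcm_gcd.
  by move=> ->; exact: dvdn_mulr.
have [|h ih hE] := has_index_dvd id (has_index_trans id1 ig).
  by move=> k [[? ?] [? ?]].
have : ~~ (p %| d1 * g) by rewrite Euclid_dvdM // negb_or pd1.
by apply: contra => pd; rewrite hE dvdn_mulr.
Qed.

(** The vertex stabilizer C of y lies in a vertex stabilizer D of X. In D, its
    conjugate t C t^-1, of index N in C, has N times the index that it has in
    t D t^-1; thus N divides the index of the intersection of D and t D t^-1 in
    D. *)
Lemma prime_ascending_index (Y : gtree G) (y : Y) t N : commensurable_tree Y ->
  ascending y t N -> ~~ (p %| N).
Proof.
move=> gbsY [_ iN]; have [c gc] := gbsY.1 y.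
have [x xc] := gbs_stab_elliptic noline gbsY (free_generator_mem gc).
have sub : stab y `<=` stab x by move=> h /gc.2[j ->]; exact: stab_zpow.
have [a ga] := gbsX.1 x.
have [m im] : exists m, has_index (stab x) (stab y) m.
  apply: (has_index_exists ga); [exact: stab_subgroup|exact: sub|].
  by exists c; [exact: free_generator_neq1 gc|exact: free_generator_mem].
have imt := has_index_conj t im; rewrite -!stab_act in imt.
have [e ie] := edge_index x (act t x) gbsX.
have [e' ie'] := edge_index (act t x) x gbsX.
have tsub : stab (act t y) `<=` stab x `&` stab (act t x).
  move=> h hy; split; last exact: has_index_sub imt hy.
  by apply: sub; exact: has_index_sub iN hy.
have [r ir rE] := has_index_dvd ie (has_index_trans im iN) tsub.
have [|r' ir' r'E] := has_index_dvd ie' imt; first by move=> h /tsub[].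
rewrite setIC in ir'; have rr := has_index_unique ir ir'.
have r0 : 0 < r by case: ir.
have eE : e = e' * N.
  by apply/eqP; rewrite -(eqn_pmul2r r0) -rE r'E -rr mulnAC.
by apply: contra (prime_vertex_index ie) => pN; rewrite eE dvdn_mull.
Qed.

End PrimeBound.

Theorem theorem4p6 (G : groupType) (X : gtree G)
    (X_cocompact : cocompact X) (X_gbs : gbs_tree X)
    (X_nonelem : ~ elementary X) :
  fully_reduced X <->
  (forall Y : gtree G, gbs_tree Y -> edge_orbits X #<= edge_orbits Y).
Proof.
have noline : ~ invariant_line X by move=> line; apply: X_nonelem; right.
have gbsX := (gbs_treeP X).1 X_gbs.
split=> [red Y /gbs_treeP gbsY|X_min]; first exact: fully_reduced_edges_le.
have [/finite_setP[n Xn] Efin] := X_cocompact; rewrite card_eq_sym in Xn.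
have [r [r_indep r_cover]] := vertex_representatives Xn.
have n_min (Y : gtree G) (s : seq Y) : commensurable_tree Y -> covers s -> n <= size s.
  move=> gbsY; apply: (covers_size_ge noline gbsX gbsY Efin r_indep).
  by apply: X_min; apply/gbs_treeP.
have Xcov : coverable X n.
  exists [seq r i | i <- enum 'I_n]; last by rewrite size_map size_enum_ord.
  move=> y; have [i [g <-]] := r_cover y; exists (r i); last by exists g.
  by apply: map_f; rewrite mem_enum.
have [L LP] := edge_index_primes gbsX Efin.
have bound (Y : gtree G) (y : Y) t N : commensurable_tree Y -> ascending y t N ->
    size (primes N) <= size L.
  move=> gbsY asc; apply: uniq_leq_size; first exact: primes_uniq.
  move=> p; rewrite mem_primes => /and3P[pp N0 pN]; apply: contraTT pN => pL.
  apply: (prime_ascending_index noline gbsX pp _ gbsY asc) => u v d uv id.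
  by apply: contra pL => pd; exact: LP uv id pp pd.
(* Each round adds a prime to those of the index, and all of them lie in L. *)
have no_ascending k (Y : gtree G) (y : Y) t N : size L - size (primes N) < k ->
    commensurable_tree Y -> coverable Y n -> ascending y t N -> ~ dominated y.
  elim: k Y y t N => // k IH Y y t N lk gbsY cov asc dom.
  have [g [z [d [gz id sm pr]]]] := dominated_exit N gbsY dom.
  have [Y' [y' [t' [N' [gbsY' cov' asc' dom' NN']]]]] :=
    ascending_grows n_min gbsY cov (ascending_act g asc) (dominated_act g dom) gz id sm pr.
  apply: (IH Y' y' t' N') => //; have := bound _ _ _ _ gbsY' asc'; lia.
move=> x y sub; apply: contrapT => xy.
have y_out g : act g x <> y by move=> E; apply: xy; apply/vertex_orbitP; exists g.
have dom : dominated x by exists y.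
have := geod_path (@tree_connected G X) x y; have := geod_last (@tree_connected G X) x y.
case E : (geod _ x y) => [|w p] /=; first by move=> xE; case: (y_out 1%g); rewrite act1.
move=> _ /andP[xw _].
have xw_sub : stab x `<=` stab w.
  by move=> g gx; apply: (tree_geod_fixed gx (sub _ gx)); rewrite /tree_geod E inE eqxx.
have [[h hw]|w_out] := pselect (exists h, act h x = w); last first.
  apply: (no_ascending_exit n_min gbsX Xcov xw) => // g gw; apply: w_out.
  by exists g.
(* The first edge of the path, read from w to x, is ascending. *)
have [N] := edge_index w x gbsX; rewrite setIC.
have -> : stab x `&` stab w = stab x.
  by apply/seteqP; split=> [g []//|g gx]; split=> //; exact: xw_sub.
move=> iN; apply: (no_ascending _ X w h^-1%g N (ltnSn _)) => //.
  by rewrite /ascending -{2 4}hw actK adj_sym.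
by rewrite -hw; exact: dominated_act.
Qed.
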